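(* Let $E$ be the weighted (LF)-space of entire functions described in the context, let $g_0\in E$ with $g_0(0)=1$, and let $f\in E$. The following assertions are equivalent: (i) $f$ is a cyclic vector for $D_{0,g_0}$ in $E$, i.e. $f\in\mathrm{Cycl}(D_{0,g_0})$. (ii) The system $\{T_z(f): z\in\mathbb C\}$ is complete in $E$. (iii) $f\notin \ker B$ for each nonzero operator $B\in\mathcal K(D_{0,g_0})$. (iv) The system $\{\widetilde T_z(f): z\in\mathbb C\}$ is complete in $E$.
   Context: The space $E$. Let $v_{n,k}:\mathbb C\to\mathbb R$ ($n,k\in\mathbb N$) be continuous functions with $v_{n,k+1}\le v_{n,k}\le v_{n+1,k}$ for all $n,k\in\mathbb N$, satisfying: for every $n$ there is $m$ such that for every $k$ there are $s$ and $C\ge 0$ with $$\sup_{|t-z|\le 1}v_{n,s}(t)+\ln(1+|z|)\le \inf_{|t-z|\le 1}v_{m,k}(t)+C\quad\text{for all } z\in\mathbb C.$$ For $v:\mathbb C\to\mathbb R$ and $f:\mathbb C\to\mathbb C$ put $p_v(f):=\sup_{z\in\mathbb C}|f(z)|/\exp v(z)$. Let $E_n:=\{f \text{ entire}: p_{v_{n,k}}(f)<+\infty\ \forall k\in\mathbb N\}$, a Fréchet space with the seminorms $p_{v_{n,k}}$, $k\in\mathbb N$. Then $E_n$ embeds continuously in $E_{n+1}$; put $E:=\bigcup_{n\in\mathbb N}E_n$ with the locally convex inductive limit topology of the sequence $(E_n)$. It is assumed that $E\neq\{0\}$ (then there is $g_0\in E$ with $g_0(0)=1$). Operators. $\mathcal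 L(E)$ is the space of continuous linear operators from $E$ to itself. For fixed $g_0\in E$ with $g_0(0)=1$ the Pommiez operator $D_{0,g_0}\in\mathcal L(E)$ is $$D_{0,g_0}(f)(t):=\frac{f(t)-g_0(t)f(0)}{t}\ (t\ne 0),\qquad D_{0,g_0}(f)(0):=f'(0)-g_0'(0)f(0).$$ For $z\in\mathbb C$ and $f\in E$ define operators $T_z,\widetilde T_z\in\mathcal L(E)$ by $$T_z(f)(t):=\frac{tf(t)g_0(z)-zf(z)g_0(t)}{t-z}\ (t\neq z),\qquad T_z(f)(z):=zg_0(z)f'(z)-zf(z)g_0'(z)+f(z)g_0(z),$$ $$\widetilde T_z(f)(t):=\frac{f(t)g_0(z)-f(z)g_0(t)}{t-z}\ (t\neq z),\qquad \widetilde T_z(f)(z):=f'(z)g_0(z)-f(z)g_0'(z).$$ $\mathcal K(D_{0,g_0})$ is the set of all $B\in\mathcal L(E)$ with $BD_{0,g_0}=D_{0,g_0}B$ on $E$. A system of vectors is complete in a locally convex space if its linear span is dense. A vector $x$ is cyclic for $A\in\mathcal L(E)$ if $\{A^n(x): n\ge 0\}$ is complete in $E$; $\mathrm{Cycl}(A)$ denotes the set of all cyclic vectors of $A$ in $E$. *)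

(* Defs.v *)
From HB Require Import structures.
From mathcomp Require Import all_boot all_order all_algebra.
From mathcomp Require Import all_classical all_reals all_analysis.
From mathcomp Require Import complex.
Import Order.TTheory GRing.Theory Num.Theory.
Import numFieldNormedType.Exports.

Set Implicit Arguments.
Unset Strict Implicit.
Unset Printing Implicit Defensive.

Local Open Scope classical_set_scope.
Local Open Scope ring_scope.

(* [^o] selects the structure of [R[i]] as a normed space over itself; [R[i]]
   without it is not equipped with a topology. *)
Notation Cplx R := ((R[i])^o).
Notation modulus := Normc.normc.

Definition unit_disc (R : realType) (z : Cplx R) : set (Cplx R) :=
  [set t | modulus (t - z) <= 1].

Record weights (R : realType) := Weights {
  wt :> nat -> nat -> Cplx R -> R;
  wt_continuous : forall n k, continuous (wt n k);
  wt_decr : forall n k z, wt n k.+1 z <= wt n k z;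
  wt_incr : forall n k z, wt n k z <= wt n.+1 k z;
  (* The real-valued [sup] and [inf] take a default value on unbounded sets;
     here the sets are images of a compact set under a continuous map. *)
  wt_growth : forall n, exists m, forall k, exists s, exists2 C : R, 0 <= C &
    forall z : Cplx R,
      sup [set wt n s t | t in unit_disc z] + ln (1 + modulus z) <=
      inf [set wt m k t | t in unit_disc z] + C
}.

Section InductiveLimit.
Variable R : realType.
Local Notation C := (Cplx R).

Definition entire (f : C -> C) := forall z : C, derivable f z 1.

Definition weighted_norm (v : C -> R) (f : C -> C) : \bar R :=
  ereal_sup (range (fun z : C => (modulus (f z) / expR (v z))%:E)).

Variable w : weights R.

Definition step (n : nat) : set (C -> C) :=
  [set f | entire f /\ forall k, (weighted_norm (w n k) f < +oo)%E].

Definition steps_union : {pred C -> C} := mem (\bigcup_n step n).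

Lemma modulusE (z : C) : `|z| = (modulus z)%:C%C.
Proof. by case: z. Qed.

Lemma modulus_ge0 (z : C) : 0 <= modulus z.
Proof. by case: z => a b; rewrite /= sqrtr_ge0. Qed.

Lemma weighted_norm_ge0 v f : (0 <= weighted_norm v f)%E.
Proof.
apply: (@le_trans _ _ (modulus (f 0) / expR (v 0))%:E).
  by rewrite lee_fin divr_ge0 ?expR_ge0 ?modulus_ge0.
by apply: ereal_sup_ubound; exists 0.
Qed.

Lemma weighted_normZ_le v (a : C) (f : C -> C) :
  (weighted_norm v (a *: f)%R <= (modulus a)%:E * weighted_norm v f)%E.
Proof.
apply: ge_ereal_sup => _ [z _ <-].
rewrite [(a *: f) z]/(a * f z) Normc.normcM -mulrA EFinM.
apply: lee_wpmul2l; first by rewrite lee_fin modulus_ge0.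
by apply: ereal_sup_ubound; exists z.
Qed.

Lemma weighted_normD_le v (f g : C -> C) :
  (weighted_norm v (f + g)%R <= weighted_norm v f + weighted_norm v g)%E.
Proof.
apply: ge_ereal_sup => _ [z _ <-].
apply: (@le_trans _ _ ((modulus (f z) / expR (v z))%:E +
                       (modulus (g z) / expR (v z))%:E)%E).
  by rewrite -EFinD lee_fin -mulrDl ler_wpM2r ?invr_ge0 ?expR_ge0 ?le_normcD.
by apply: leeD; apply: ereal_sup_ubound; exists z.
Qed.

Lemma weighted_norm_mono v v' f : (forall z, v z <= v' z) ->
  (weighted_norm v' f <= weighted_norm v f)%E.
Proof.
move=> vv'; apply: ge_ereal_sup => _ [z _ <-].
apply: (@le_trans _ _ (modulus (f z) / expR (v z))%:E); last first.
  by apply: ereal_sup_ubound; exists z.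
by rewrite lee_fin ler_wpM2l ?modulus_ge0// lef_pV2 ?posrE ?expR_gt0// ler_expR.
Qed.

Lemma step_incr n m : (n <= m)%N -> step n `<=` step m.
Proof.
move=> nm f [ef nf]; split=> // k; apply: le_lt_trans (nf k).
apply: weighted_norm_mono => z.
apply: (@homo_leq _ (fun j => w j k z) (fun x y : R => x <= y)) nm => //.
  by move=> x y t; exact: le_trans.
by move=> j; exact: wt_incr.
Qed.

Lemma step0 n : step n 0.
Proof.
split=> [z|k]; first exact: derivable_cst.
apply: le_lt_trans (ltry 0); apply: ge_ereal_sup => _ [z _ <-].
by rewrite Normc.normc0 mul0r.
Qed.

Lemma stepZ n (a : C) f : step n f -> step n (a *: f).
Proof.
move=> [ef nf]; split=> [z|k].
  exact: derivableZ.
apply: le_lt_trans (weighted_normZ_le _ _ _) _.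
apply: lte_mul_pinfty => //; by rewrite lee_fin modulus_ge0.
Qed.

Lemma stepD n f g : step n f -> step n g -> step n (f + g).
Proof.
move=> [ef nf] [eg ng]; split=> [z|k]; first exact: derivableD.
by apply: le_lt_trans (weighted_normD_le _ _ _) _; exact: lte_add_pinfty.
Qed.

Lemma steps_union_submod_closed : submod_closed steps_union.
Proof.
split; first by rewrite inE; exists 0%N => //; exact: step0.
move=> a f g; rewrite !inE => -[n _ fn] [m _ gm].
exists (maxn n m) => //; apply: stepD.
  by apply: stepZ; apply: step_incr fn; exact: leq_maxl.
by apply: step_incr gm; exact: leq_maxr.
Qed.

HB.instance Definition _ :=
  GRing.isSubmodClosed.Build R[i] (C -> C) steps_union
    steps_union_submod_closed.

Record LFspace := LFSpace { LFfun :> C -> C; LFfunP : LFfun \in steps_union }.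

HB.instance Definition _ := [isSub for LFfun].
HB.instance Definition _ := [Choice of LFspace by <:].
HB.instance Definition _ := [SubChoice_isSubLmodule of LFspace by <:].

Local Notation E := LFspace.

Definition absolutely_convex (V : set E) := forall (a b : R[i]) (x y : E),
  modulus a + modulus b <= 1 -> V x -> V y -> V (a *: x + b *: y).

(* The trace of [V] on the [n]-th step contains a neighbourhood of 0 for the
   topology that the seminorms [weighted_norm (w n k)], k in nat, define. *)
Definition step_nbhs0 (n : nat) (V : set E) :=
  exists k : nat, exists2 eps : R, 0 < eps & forall f : E, step n f ->
    (forall j, (j <= k)%N -> (weighted_norm (w n j) f < eps%:E)%E) -> V f.

(* Standard base of neighbourhoods of 0 of the locally convex inductive limit
   of the steps, i.e. of the finest locally convex topology on their union for
   which every inclusion of a step is continuous. *)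
Definition LF_base (V : set E) :=
  absolutely_convex V /\ forall n, step_nbhs0 n V.

Definition LF_nbhs (x : E) : set_system E :=
  [set A | exists2 V, LF_base V & forall y, V (y - x) -> A y].

Lemma LFZE (a : R[i]) (x : E) : LFfun (a *: x) = (a *: (LFfun x : C -> C)).
Proof. by []. Qed.

Lemma LF_step (x : E) : exists n, step n x.
Proof. by have := LFfunP x; rewrite inE => -[n _ xn]; exists n. Qed.

Lemma LF_baseT : LF_base setT.
Proof. by split=> // n; exists 0%N; exists 1. Qed.

Lemma LF_baseI V W : LF_base V -> LF_base W -> LF_base (V `&` W).
Proof.
move=> [aV sV] [aW sW]; split=> [a b x y ab [Vx Wx] [Vy Wy]|n].
  by split; [exact: aV|exact: aW].
have [k [e e0 H]] := sV n; have [k' [e' e'0 H']] := sW n.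
exists (maxn k k'); exists (Num.min e e') => [|f fn nf].
  by rewrite lt_min e0.
have nf' j : (j <= maxn k k')%N ->
    (weighted_norm (w n j) f < e%:E)%E /\ (weighted_norm (w n j) f < e'%:E)%E.
  move=> /nf h; split; apply: (lt_le_trans h); rewrite lee_fin ge_min lexx//.
  by rewrite orbT.
split; [apply: H|apply: H'] => // j jk; apply nf'; apply: (leq_trans jk).
- exact: leq_maxl.
- exact: leq_maxr.
Qed.

Lemma LF_base0 V : LF_base V -> V 0.
Proof.
move=> [_ /(_ 0%N)[k [e e0]]]; apply; first exact: step0.
move=> j _; apply: (@le_lt_trans _ _ 0%E); last by rewrite lte_fin.
by apply: ge_ereal_sup => _ [z _ <-]; rewrite Normc.normc0 mul0r.
Qed.

Lemma LF_base_bal V (a : R[i]) x : LF_base V -> modulus a <= 1 -> V x ->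
  V (a *: x).
Proof.
move=> bV a1 Vx; have := bV.1 a 0 x 0; rewrite scale0r addr0; apply => //.
  by rewrite Normc.normc0 addr0.
exact: LF_base0.
Qed.

Lemma modulus_nneg (r : R) : 0 <= r -> modulus r%:C%C = r.
Proof. by move=> r0; rewrite /= expr0n /= addr0 sqrtr_sqr ger0_norm. Qed.

Lemma LF_base_half V x y : LF_base V -> V (2 *: x) -> V (2 *: y) -> V (x + y).
Proof.
move=> bV Vx Vy; have := bV.1 (2^-1)%:C%C (2^-1)%:C%C _ _ _ Vx Vy.
have h : ((2^-1)%:C%C : R[i]) * 2 = 1.
  have -> : (2 : R[i]) = (2 : R)%:C%C by rewrite rmorph_nat.
  by rewrite -rmorphM mulVf ?rmorph1.
rewrite !scalerA h !scale1r; apply; rewrite modulus_nneg ?invr_ge0//.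
by rewrite -[2^-1]mul1r -splitr.
Qed.

Lemma LF_base_scale V (a : R[i]) : LF_base V ->
  LF_base [set x | V (a *: x)].
Proof.
move=> [aV sV]; split=> [b c x y bc Vx Vy|n].
  suff h : a *: (b *: x + c *: y) = b *: (a *: x) + c *: (a *: y).
    by rewrite /= h; exact: aV.
  by rewrite scalerDr !scalerA ![a * _]mulrC.
have [k [e e0 H]] := sV n; exists k; exists (e / (modulus a + 1)) => [|f fn nf].
  by rewrite divr_gt0// ltr_wpDl ?modulus_ge0.
have a1 : 0 < modulus a + 1 by rewrite ltr_wpDl ?modulus_ge0.
apply: H => [|j jk]; first exact: stepZ.
rewrite LFZE; apply: le_lt_trans (weighted_normZ_le _ _ _) _.
apply: (@le_lt_trans _ _ ((modulus a + 1)%:E * weighted_norm (w n j) f)%E).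
  by apply: lee_wpmul2r; rewrite ?weighted_norm_ge0// lee_fin lerDl.
by rewrite muleC -lte_pdivlMr//; exact: nf.
Qed.

Lemma LF_base_absorb V x : LF_base V -> exists2 r : R, 0 < r & V (r%:C%C *: x).
Proof.
move=> [aV sV]; have [n xn] := LF_step x; have [k [e e0 H]] := sV n.
pose M := \sum_(j < k.+1) fine (weighted_norm (w n j) x).
have M0 : 0 <= M by apply: sumr_ge0 => j _; rewrite fine_ge0 ?weighted_norm_ge0.
have M1 : 0 < M + 1 by rewrite ltr_wpDl.
exists (e / (M + 1)); first by rewrite divr_gt0.
apply: H => [|j jk]; first exact: stepZ.
rewrite LFZE; apply: le_lt_trans (weighted_normZ_le _ _ _) _.
rewrite modulus_nneg ?divr_ge0 ?ltW//.
have fj : weighted_norm (w n j) x \is a fin_num.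
  by rewrite ge0_fin_numE ?weighted_norm_ge0//; exact: xn.2.
rewrite -(fineK fj) -EFinM lte_fin -mulrA gtr_pMr// mulrC ltr_pdivrMr// mul1r.
apply: (@le_lt_trans _ _ M); last by rewrite ltrDl.
have jk' : (j < k.+1)%N by [].
rewrite /M (bigD1 (Ordinal jk'))//= lerDl sumr_ge0// => i _.
by rewrite fine_ge0 ?weighted_norm_ge0.
Qed.

HB.instance Definition _ := hasNbhs.Build E LF_nbhs.

Lemma LF_nbhsE (x : E) (A : set E) :
  nbhs x A <-> exists2 V, LF_base V & forall y, V (y - x) -> A y.
Proof. by []. Qed.

Lemma LF_nbhs_filter (x : E) : ProperFilter (nbhs x).
Proof.
split.
  move=> /LF_nbhsE[V bV /(_ x)]; apply; rewrite subrr; exact: LF_base0.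
split.
- by apply/LF_nbhsE; exists setT => //; exact: LF_baseT.
- move=> A B /LF_nbhsE[V bV VA] /LF_nbhsE[W bW WB]; apply/LF_nbhsE.
  by exists (V `&` W) => [|y [/VA ? /WB ?]//]; exact: LF_baseI.
- move=> A B AB /LF_nbhsE[V bV VA]; apply/LF_nbhsE; exists V => // y /VA.
  exact: AB.
Qed.

Lemma LF_nbhs_singleton (x : E) (A : set E) : nbhs x A -> A x.
Proof.
by move=> /LF_nbhsE[V bV]; apply; rewrite subrr; exact: LF_base0.
Qed.

Lemma LF_nbhs_nbhs (x : E) (A : set E) : nbhs x A -> nbhs x (nbhs^~ A).
Proof.
move=> /LF_nbhsE[V bV VA]; apply/LF_nbhsE.
exists [set x | V (2 *: x)]; first exact: LF_base_scale.
move=> y Vy; apply/LF_nbhsE; exists [set x | V (2 *: x)].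
  exact: LF_base_scale.
move=> z Vz; apply: VA; rewrite -(subrK y z) -addrA.
exact: LF_base_half.
Qed.

HB.instance Definition _ := Nbhs_isNbhsTopological.Build E
  LF_nbhs_filter LF_nbhs_singleton LF_nbhs_nbhs.

Lemma LF_add_continuous : continuous (fun x : E * E => x.1 + x.2).
Proof.
move=> [x y] A /LF_nbhsE[V bV VA].
exists ([set u | V (2 *: (u - x))], [set u | V (2 *: (u - y))]).
  by split; apply/LF_nbhsE; exists [set x | V (2 *: x)] => //;
    exact: LF_base_scale.
move=> [u v] [/= Vu Vv]; apply: VA => /=; rewrite opprD addrACA.
exact: LF_base_half.
Qed.

Lemma LF_scale_continuous : continuous (fun z : R[i]^o * E => z.1 *: z.2).
Proof.
move=> [c x] A /LF_nbhsE[V bV VA].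
have [r r0 Vr] := LF_base_absorb x (LF_base_scale 2 bV).
pose d := Num.min 1 r; pose m := modulus c + 1.
have m0 : 0 <= m by rewrite addr_ge0 ?modulus_ge0.
exists ([set b : R[i]^o | modulus (b - c) < d],
        [set u | V ((2 * m%:C%C) *: (u - x))]).
  split; last first.
    by apply/LF_nbhsE; exists [set x | V ((2 * m%:C%C) *: x)] => //;
      exact: LF_base_scale.
  apply/nbhs_ballP; exists d%:C%C.
    by rewrite /= ltcR lt_min ltr01.
  move=> b; rewrite -ball_normE /= distrC modulusE ltcR.
  by [].
move=> [b u] [/= bd Vu]; apply: VA => /=.
have -> : b *: u - c *: x = b *: (u - x) + (b - c) *: x.
  by rewrite scalerBr scalerBl addrA subrK.
have bm : modulus b <= m.
  rewrite -(subrK c b) (le_trans (le_normcD _ _))// addrC lerD2l.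
  by apply: ltW (lt_le_trans bd _); rewrite ge_min lexx.
have m1 : 0 < m by rewrite ltr_wpDl ?modulus_ge0.
have mC : m%:C%C != 0 :> R[i] by rewrite eq_complex /= eqxx andbT gt_eqF.
have rC : r%:C%C != 0 :> R[i] by rewrite eq_complex /= eqxx andbT gt_eqF.
apply: LF_base_half => //.
  have h : 2 *: (b *: (u - x)) = (b / m%:C%C) *: ((2 * m%:C%C) *: (u - x)).
    rewrite !scalerA; congr (_ *: _).
    by rewrite [2 * m%:C%C]mulrC mulrA divfK// mulrC.
  rewrite /= h; apply: LF_base_bal => //.
  rewrite Normc.normcM Normc.normcV modulus_nneg//.
  by rewrite ler_pdivrMr// mul1r.
have h : 2 *: ((b - c) *: x) = ((b - c) / r%:C%C) *: (2 *: (r%:C%C *: x)).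
  rewrite !scalerA; congr (_ *: _).
  by rewrite [2 * r%:C%C]mulrC mulrA divfK// mulrC.
rewrite /= h; apply: LF_base_bal => //.
rewrite Normc.normcM Normc.normcV (modulus_nneg (ltW r0)).
rewrite ler_pdivrMr// mul1r.
by apply: ltW (lt_le_trans bd _); rewrite ge_min lexx orbT.
Qed.

Lemma LF_locally_convex : exists2 B : set_system E,
  (forall b, b \in B -> convex_set b) & basis B.
Proof.
exists [set b : set E | open b /\ convex_set b].
  by move=> b /set_mem [].
split; first by move=> b [].
move=> x A /LF_nbhsE[V bV VA].
exists [set y | nbhs y [set z | V (z - x)]] => /=.
  split; last first.
    by apply/LF_nbhsE; exists V.
  split.
    rewrite openE => y /= /LF_nbhs_nbhs; exact.
  move=> y z l /set_mem /= /LF_nbhsE[V1 b1 h1] /set_mem /= /LF_nbhsE[V2 b2 h2].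
  apply/mem_set/LF_nbhsE; exists (V1 `&` V2); first exact: LF_baseI.
  move=> t [t1 t2].
  have V1t : V (t - conv l y z + y - x) by apply: h1; rewrite addrK.
  have V2t : V (t - conv l y z + z - x) by apply: h2; rewrite addrK.
  pose q : R[i] := l%:num.
  have q0 : 0 <= q by rewrite /q ge0.
  have q1 : 0 <= 1 - q by rewrite subr_ge0; rewrite /q le1.
  have qE : modulus q + modulus (1 - q) <= 1.
    rewrite -lecR rmorphD /= -!modulusE !ger0_norm// addrC subrK.
    by [].
  have := bV.1 q (1 - q) _ _ qE V1t V2t.
  set u := t - _; have tE : t = u + (q *: (y : E) + (1 - q) *: (z : E)).
    by rewrite /u subrK.
  clearbody u.
  suff -> : q *: (u + y - x) + (1 - q) *: (u + z - x) = t - x by [].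
  rewrite [in RHS]tE -!addrA !scalerDr addrACA -scalerDl [q + _]addrC subrK.
  rewrite scale1r; congr (_ + _).
  by rewrite addrACA -scalerDl [q + (1 - q)]addrC subrK scale1r addrA.
move=> y /LF_nbhs_singleton /= ; exact: VA.
Qed.

HB.instance Definition _ := PreTopologicalLmod_isTvs.Build R[i] E
  LF_add_continuous LF_scale_continuous LF_locally_convex.
(* The factory above only provides the uniform structure. *)
HB.instance Definition _ :=
  PreTopologicalNmodule_isTopologicalNmodule.Build E LF_add_continuous.
HB.instance Definition _ :=
  TopologicalNmodule_isTopologicalLmodule.Build R[i] E LF_scale_continuous.
HB.instance Definition _ := Uniform_isTvs.Build R[i] E LF_locally_convex.

End InductiveLimit.

Section CompleteSystems.
Variables (K : numDomainType) (V : tvsType K).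

Definition lin_span (S : set V) : set V :=
  [set x | exists n (c : 'I_n -> K) (u : 'I_n -> V),
    (forall i, S (u i)) /\ x = \sum_(i < n) c i *: u i].

Definition complete_system (S : set V) := dense (lin_span S).

Definition cyclic_vectors (A : V -> V) : set V :=
  [set x | complete_system (range (fun n => iter n A x))].

Definition commutant (A : V -> V) : set {linear V -> V} :=
  [set B | continuous B /\ forall x, B (A x) = A (B x)].

End CompleteSystems.

Section Operators.
Variables (R : realType) (w : weights R).
Local Notation C := (Cplx R).
Local Notation E := (LFspace w).

Definition pommiez_fun (g f : C -> C) (t : C) : C :=
  if t == 0 then derive1 f 0 - derive1 g 0 * f 0
  else (f t - g t * f 0) / t.

Definition T_fun (g : C -> C) (z : C) (f : C -> C) (t : C) : C :=
  if t == z then z * g z * derive1 f z - z * f z * derive1 g z + f z * g z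
  else (t * f t * g z - z * f z * g t) / (t - z).

Definition Ttilde_fun (g : C -> C) (z : C) (f : C -> C) (t : C) : C :=
  if t == z then derive1 f z * g z - f z * derive1 g z
  else (f t * g z - f z * g t) / (t - z).

(* The three formulas above yield entire functions with removable singularities,
   and [wt_growth] keeps them in the space whenever [f] and [g] are there, so
   the default value 0 of [insubd] is never taken below. *)
Definition to_LF (h : C -> C) : E := insubd (0 : E) h.

Definition pommiez (g f : E) : E := to_LF (pommiez_fun g f).
Definition T_op (g : E) (z : C) (f : E) : E := to_LF (T_fun g z f).
Definition Ttilde_op (g : E) (z : C) (f : E) : E := to_LF (Ttilde_fun g z f).

End Operators.

(* Main.v *)
From HB Require Import structures.
Require Import Defs.
From mathcomp Require Import all_boot all_order all_algebra.
From mathcomp Require Import all_classical all_reals all_analysis.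
From mathcomp Require Import complex ring lra.
Import Order.TTheory GRing.Theory Num.Theory.
Import numFieldNormedType.Exports.

Set Implicit Arguments.
Unset Strict Implicit.
Unset Printing Implicit Defensive.

Local Open Scope classical_set_scope.
Local Open Scope ring_scope.

(** Write [D] for the Pommiez operator [pommiez g0]. Everything is compared with
    assertion (iii), through a correspondence between continuous linear functionals
    [phi] and operators [B] of the commutant of [D]: to [phi] belongs the operator
    [B h = (z |-> phi (T_z h))], and to [B] the functional [h |-> B h 0]. Since
    [T_0 h = h], the operator of [phi] takes the value [phi h] at 0. It commutes with
    [D] by the identities [T_z h = g0(z) h + z Ttilde_z h] and [T_z (D h) = Ttilde_z h].
    Conversely two operators of the commutant with the same values at 0 agree, since
    a function [u] with [D ^ n u] zero at 0 for all [n] is divisible by all powers of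
    [t] and hence 0 ([pommiez_orbit_eq0]).

    By the Hahn-Banach theorem ([not_complete_dual]), a system is complete if and only
    if no nonzero continuous functional vanishes on it. With [B] the operator of [phi],
    [phi] vanishes on all [T_z f] if and only if [B f = 0]; and it vanishes on all
    [D ^ n f = T_0 (D ^ n f)] if and only if [D ^ n (B f)] is zero at 0 for all [n],
    which again means [B f = 0]. This gives (i) and (ii) ([complete_avoids]). As
    [Ttilde_z f = T_z (D f)], assertion (iv) is (ii) for [D f], so that it amounts to
    (iii) for [D f]; and this is (iii) for [f], because [D] is onto and composition
    with [D] stays within the commutant.

    Complex analysis enters in showing that the functions at hand are entire and lie
    in the space, from pointwise differentiability alone. Goursat's bisection is run
    on trapezoid sums in place of integrals ([goursat]) and yields [|f z| <= 4 M] for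
    an entire [f] bounded by [M] on a shell around [z] ([center_bound]). Applied to
    [G ^ n] times a polynomial, as [n] grows, this becomes the maximum principle for
    functions [G] that are continuous and differentiable off finitely many points
    ([max_modulus_off], [max_modulus]). The principle shows that divided differences
    of entire functions are entire ([dquot_entire]), which covers [D], [T_z] and
    [Ttilde_z]; that they satisfy the growth estimates ([Ttilde_fun_bound]); that
    [phi (T_z h)] is differentiable in [z] ([Ttilde_transform_entire]); and that
    [pommiez_orbit_eq0] holds. *)

(** * The modulus of complex numbers *)

Section Modulus.
Variable R : realType.
Local Notation C := (Cplx R).

Lemma modulusN (x : C) : modulus (- x) = modulus x.
Proof. exact: normcN. Qed.

Lemma modulus_distC (x y : C) : modulus (x - y) = modulus (y - x).
Proof. by rewrite -modulusN opprB. Qed.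

Lemma modulusX (x : C) n : modulus (x ^+ n) = modulus x ^+ n.
Proof.
elim: n => [|n IH]; first by rewrite !expr0 Normc.normc1.
by rewrite !exprS Normc.normcM IH.
Qed.

Lemma modulus_div (x y : C) : modulus (x / y) = modulus x / modulus y.
Proof. by rewrite Normc.normcM Normc.normcV. Qed.

Lemma modulusD_le (x y : C) : modulus (x + y) <= modulus x + modulus y.
Proof. exact: le_normcD. Qed.

Lemma modulusB_le (x y : C) : modulus (x - y) <= modulus x + modulus y.
Proof. by rewrite -(modulusN y) modulusD_le. Qed.

Lemma modulusB_ge (x y : C) : modulus x - modulus y <= modulus (x - y).
Proof. by have := modulusD_le (x - y) y; rewrite subrK; lra. Qed.

Lemma modulus_triangle (x y z : C) : modulus (x - z) <= modulus (x - y) + modulus (y - z).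
Proof. by have := modulusD_le (x - y) (y - z); rewrite addrA subrK. Qed.

Lemma modulus_le0 (x : C) : modulus x <= 0 -> x = 0.
Proof.
by move=> x0; apply: Normc.eq0_normc; apply/eqP; rewrite eq_le x0 modulus_ge0.
Qed.

Lemma modulus_gt0 (x : C) : x != 0 -> 0 < modulus x.
Proof.
move=> x0; rewrite lt_neqAle modulus_ge0 andbT eq_sym.
by apply: contra x0 => /eqP/Normc.eq0_normc ->.
Qed.

Lemma modulus_nat n : modulus (n%:R : C) = n%:R.
Proof. by rewrite -(rmorph_nat (real_complex R)) modulus_nneg. Qed.

Lemma normr_Re_le_modulus (x : C) : `|complex.Re x| <= modulus x.
Proof. by case: x => a b /=; rewrite -sqrtr_sqr ler_wsqrtr// lerDl sqr_ge0. Qed.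

Lemma normr_Im_le_modulus (x : C) : `|complex.Im x| <= modulus x.
Proof. by case: x => a b /=; rewrite -sqrtr_sqr ler_wsqrtr// lerDr sqr_ge0. Qed.

Lemma Re_le_modulus (x : C) : complex.Re x <= modulus x.
Proof. exact: le_trans (ler_norm _) (normr_Re_le_modulus x). Qed.

Lemma Im_le_modulus (x : C) : complex.Im x <= modulus x.
Proof. exact: le_trans (ler_norm _) (normr_Im_le_modulus x). Qed.

Lemma gt0_real (e : C) : 0 < e -> e = (complex.Re e)%:C%C.
Proof. by case: e => a b; rewrite ltcE => /andP[/eqP/= -> _]. Qed.

Lemma real_neq0 (s : R) : 0 < s -> (s%:C%C : C) != 0.
Proof.
move=> s0; apply/eqP => sE; have := modulus_nneg (ltW s0).
by rewrite sE Normc.normc0 => s0'; rewrite s0' ltxx in s0.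
Qed.

End Modulus.

(** * Complex derivatives *)

Section ComplexDerivative.
Variable R : realType.
Local Notation C := (Cplx R).
Implicit Types (f g : C -> C) (z l : C).

(** Differentiability with the errors measured in [R]: the norm of [C] as a normed
    space over itself takes its values in [C]. *)
Definition has_deriv f z l := forall e : R, 0 < e -> exists2 d : R, 0 < d &
  forall h, modulus h < d -> modulus (f (z + h) - f z - l * h) <= e * modulus h.

Lemma near_modulus z (P : C -> Prop) :
  (\forall t \near z, P t) <->
  (exists2 d : R, 0 < d & forall h, modulus h < d -> P (z + h)).
Proof.
split=> [/nbhs_ballP[d /= d0 H]|[d d0 H]].
  have dE := gt0_real d0; rewrite dE in d0 H; rewrite ltcR in d0.
  exists (complex.Re d) => // h hd; apply: H.
  by rewrite -ball_normE /= opprD addrA subrr add0r normrN modulusE ltcR.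
apply/nbhs_ballP; exists d%:C%C; first by rewrite /= ltcR.
move=> t; rewrite -ball_normE /= distrC modulusE ltcR => td.
by have := H (t - z) td; rewrite addrC subrK.
Qed.

Lemma dnear_modulus z (P : C -> Prop) :
  (\forall t \near z^', P t) <->
  (exists2 d : R, 0 < d & forall h, modulus h < d -> h != 0 -> P (z + h)).
Proof.
split=> [H|[d d0 H]].
  have /near_modulus[d d0 {}H] : \forall t \near z, t != z -> P t by exact: H.
  exists d => // h hd h0; apply: H => //.
  by rewrite addrC -subr_eq0 addrK.
suff : \forall t \near z, t != z -> P t by [].
apply/near_modulus; exists d => // h hd h0; apply: H => //.
by apply: contra h0 => /eqP ->; rewrite addr0.
Qed.

Lemma derivable_has_deriv f z : derivable f z 1 -> has_deriv f z (derive1 f z).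
Proof.
move=> df e e0; rewrite derive1E.
have /cvgrPdist_le/(_ e%:C%C) := df; rewrite ltcR => /(_ e0).
rewrite -/(derive f z 1) => /dnear_modulus[d d0 H]; exists d => // h hd.
have [->|h0] := eqVneq h 0.
  by rewrite addr0 mulr0 subr0 subrr Normc.normc0 mulr0.
have := H h hd h0; rewrite add0r /= [h *: 1]mulr1 [h + z]addrC => H1.
have -> : f (z + h) - f z - 'D_1 f z * h =
    - (h * ('D_1 f z - h^-1 *: (f (z + h) - f z))).
  rewrite [_ *: (_ - _)]/(_ * _).
  by rewrite mulrBr mulrA mulfV// mul1r opprB mulrC.
rewrite modulusN Normc.normcM mulrC ler_wpM2r ?modulus_ge0//.
by move: H1; rewrite modulusE lecR.
Qed.

Lemma has_deriv_cvg f z l : has_deriv f z l ->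
  h^-1 *: (f (h *: 1 + z) - f z) @[h --> (0:C)^'] --> l.
Proof.
move=> H; apply/cvgrPdist_le => e e0.
have eE := gt0_real e0; rewrite eE ltcR in e0 *; have [d d0 {}H] := H _ e0.
apply/dnear_modulus; exists d => // h hd h0; rewrite add0r.
rewrite [h *: 1]mulr1 [h + z]addrC modulusE lecR.
have -> : l - h^-1 *: (f (z + h) - f z) = - ((f (z + h) - f z - l * h) / h).
  rewrite [_ *: (_ - _)]/(_ * _).
  by rewrite mulrBl mulfK// opprB mulrC.
by rewrite modulusN modulus_div ler_pdivrMr ?modulus_gt0//; exact: H.
Qed.

Lemma has_deriv_derivable f z l : has_deriv f z l -> derivable f z 1.
Proof. by move=> /has_deriv_cvg H; apply/cvg_ex; exists l. Qed.

Lemma has_deriv_derive1 f z l : has_deriv f z l -> derive1 f z = l.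
Proof. by move=> /has_deriv_cvg H; rewrite derive1E; apply/cvg_lim. Qed.

Lemma derivable_has_derivP f z : derivable f z 1 <-> exists l, has_deriv f z l.
Proof.
split=> [/derivable_has_deriv|[l /has_deriv_derivable//]]; by exists (derive1 f z).
Qed.

Lemma has_deriv_congr f g z l d : 0 < d ->
  (forall h, modulus h < d -> f (z + h) = g (z + h)) ->
  has_deriv f z l -> has_deriv g z l.
Proof.
move=> d0 fg H e e0; have [d' d'0 {}H] := H e e0.
exists (Num.min d d'); first by rewrite lt_min d0.
move=> h; rewrite lt_min => /andP[hd hd']; rewrite -fg//.
have <- : f z = g z by rewrite -(addr0 z) fg ?Normc.normc0.
exact: H.
Qed.

Lemma continuous_modulusP f z : {for z, continuous f} <->
  forall e : R, 0 < e -> exists2 d : R, 0 < d &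
    forall h, modulus h < d -> modulus (f (z + h) - f z) <= e.
Proof.
split=> [/cvgrPdist_le H e e0|H].
  have /near_modulus[d d0 {}H] : \forall t \near z, `|f z - f t| <= e%:C%C.
    by apply: H; rewrite ltcR.
  by exists d => // h /H; rewrite distrC modulusE lecR.
apply/(@cvgrPdist_le _ C _ (nbhs z)) => e e0.
have eE := gt0_real e0; rewrite eE ltcR in e0 *; have [d d0 {}H] := H _ e0.
apply/near_modulus; exists d => // h /H; by rewrite distrC modulusE lecR.
Qed.

Lemma derivable_mul f g z : derivable f z 1 -> derivable g z 1 ->
  derivable (fun t => f t * g t : C) z 1.
Proof.
move=> df dg; have := @derivableM _ C f g z 1 df dg.
by congr (derivable _ z 1); apply/funext => t.
Qed.

Lemma derivable_add f g z : derivable f z 1 -> derivable g z 1 ->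
  derivable (fun t => f t + g t : C) z 1.
Proof.
move=> df dg; have := @derivableD _ C C f g z 1 df dg.
by congr (derivable _ z 1); apply/funext => t.
Qed.

Lemma derivable_sub f g z : derivable f z 1 -> derivable g z 1 ->
  derivable (fun t => f t - g t : C) z 1.
Proof.
move=> df dg; have := @derivableB _ C C f g z 1 df dg.
by congr (derivable _ z 1); apply/funext => t.
Qed.

Lemma derivable_exp f z n : derivable f z 1 ->
  derivable (fun t => f t ^+ n : C) z 1.
Proof.
move=> df; elim: n => [|n IH]; first exact: derivable_cst.
under eq_fun do rewrite exprS; exact: derivable_mul.
Qed.

Lemma derivable_subr (a z : C) : derivable (fun t : C => t - a : C) z 1.
Proof. by apply: derivable_sub; [exact: derivable_id|exact: derivable_cst]. Qed.

Lemma derivable_div (a : C) f z : z != a -> derivable f z 1 ->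
  derivable (fun t => f t / (t - a) : C) z 1.
Proof.
move=> za df; apply: (derivable_mul (g := fun t : C => (t - a)^-1 : C) df).
have za0 : z - a != 0 by rewrite subr_eq0.
have := @derivableV _ C (fun t : C => t - a) z 1 za0 (@derivable_subr a z).
by congr (derivable _ z 1); apply/funext => t.
Qed.

Lemma derivable_affine f (a r t : C) : derivable f (a + r * t) 1 ->
  derivable (fun s => f (a + r * s)) t 1.
Proof.
move=> /derivable_has_derivP[l H]; apply/derivable_has_derivP; exists (l * r) => e e0.
have r1 : 0 < modulus r + 1 by rewrite ltr_wpDl ?modulus_ge0.
have [d d0 {}H] := H (e / (modulus r + 1)) (divr_gt0 e0 r1).
exists (d / (modulus r + 1)) => [|h hd]; first by rewrite divr_gt0.
have rh : modulus (r * h) <= modulus h * (modulus r + 1).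
  by rewrite Normc.normcM mulrC ler_wpM2l ?modulus_ge0// lerDl.
rewrite mulrDr addrA -mulrA; apply: le_trans (H _ _) _.
  by apply: le_lt_trans rh _; rewrite -ltr_pdivlMr.
by rewrite -mulrA ler_pM2l// ler_pdivrMl// [_ * modulus h]mulrC.
Qed.

Lemma derivable_continuous f z : derivable f z 1 -> {for z, continuous f}.
Proof. by move=> df; apply/differentiable_continuous/derivable1_diffP. Qed.

Lemma continuous_mul f g z : {for z, continuous f} -> {for z, continuous g} ->
  {for z, continuous (fun t => f t * g t : C)}.
Proof.
move=> cf cg; have := @continuousM _ C f g z cf cg.
by congr {for z, continuous _}; apply/funext => t.
Qed.

Lemma continuous_exp f z n : {for z, continuous f} ->
  {for z, continuous (fun t => f t ^+ n : C)}.
Proof.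
move=> df; elim: n => [|n IH]; first exact: cst_continuous.
suff E : (fun t : C => f t * f t ^+ n : C) = (fun t => f t ^+ n.+1).
  by case: _ / E; exact: continuous_mul.
by apply/funext => t; rewrite exprS.
Qed.

(** The difference quotient at [a] is [f] itself, so that a zero at [a] makes up
    for a missing derivative there. *)
Lemma derivable_subr_mul f a : {for a, continuous f} ->
  derivable (fun t => (t - a) * f t : C) a 1.
Proof.
move=> /continuous_modulusP cf; apply/derivable_has_derivP; exists (f a) => e /cf[d d0 H].
exists d => // h /H hf; rewrite subrr mul0r subr0 [a + h]addrC addrK.
rewrite [f a * h]mulrC -mulrBr Normc.normcM mulrC ler_wpM2r ?modulus_ge0//.
by rewrite [h + a]addrC.
Qed.

End ComplexDerivative.

(** * Trapezoid sums along triangles *)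

Section Trapezoid.
Variable R : realType.
Local Notation C := (Cplx R).
Implicit Types (f g : C -> C) (p q a b c : C) (P : C -> Prop).

(** The trapezoid sum of [f] over [2 ^ N] equal parts of the segment from [p] to
    [q]; it replaces the contour integral. Defined by recursion on midpoints, these
    sums add up exactly when a triangle is cut along its midlines. *)
Fixpoint edge_sum f N p q : C :=
  if N is N'.+1 then edge_sum f N' p ((p + q) / 2) + edge_sum f N' ((p + q) / 2) q
  else (f p + f q) / 2 * (q - p).

Definition triangle_sum f N a b c : C :=
  edge_sum f N a b + edge_sum f N b c + edge_sum f N c a.

(** All nodes of the trapezoid sums on a segment lie in such a set as soon as its
    ends do. Discs and half-planes are the examples in use. *)
Definition midpoint_closed P := forall p q, P p -> P q -> P ((p + q) / 2).

Lemma edge_sum_sym f N p q : edge_sum f N q p = - edge_sum f N p q.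
Proof.
elim: N p q => [|N IH] p q /=; first by field.
by rewrite [q + p]addrC (IH _ q) (IH p) opprD [RHS]addrC.
Qed.

Lemma edge_sum_affine u v N p q :
  edge_sum (fun t => u + v * t) N p q = (u + v * ((p + q) / 2)) * (q - p).
Proof.
elim: N p q => [|N IH] p q /=; first by field.
by rewrite !IH; field.
Qed.

Lemma edge_sum_subZ f g (k : C) N p q :
  edge_sum (fun t => f t - k * g t) N p q = edge_sum f N p q - k * edge_sum g N p q.
Proof.
elim: N p q => [|N IH] p q /=; first by field.
by rewrite !IH; ring.
Qed.

Lemma modulus_half (x : C) : modulus (x / 2) = modulus x / 2.
Proof. by rewrite modulus_div modulus_nat. Qed.

Lemma edge_sum_bound P f M N p q : midpoint_closed P ->
  (forall t, P t -> modulus (f t) <= M) -> P p -> P q ->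
  modulus (edge_sum f N p q) <= M * modulus (q - p).
Proof.
move=> cP fM; elim: N p q => [|N IH] p q Pp Pq /=.
  rewrite Normc.normcM modulus_half ler_wpM2r ?modulus_ge0// ler_pdivrMr//.
  by apply: le_trans (modulusD_le _ _) _; rewrite mulr_natr mulr2n lerD ?fM.
have Pm := cP _ _ Pp Pq.
apply: le_trans (modulusD_le _ _) _.
apply: le_trans (lerD (IH _ _ Pp Pm) (IH _ _ Pm Pq)) _.
have -> : (p + q) / 2 - p = (q - p) / 2 by field.
have -> : q - (p + q) / 2 = (q - p) / 2 by field.
by rewrite modulus_half -mulrDr -splitr.
Qed.

Lemma triangle_sum_bound P f M N a b c : midpoint_closed P ->
  (forall t, P t -> modulus (f t) <= M) -> P a -> P b -> P c ->
  modulus (triangle_sum f N a b c) <=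
    M * (modulus (b - a) + modulus (c - b) + modulus (a - c)).
Proof.
move=> cP fM Pa Pb Pc; rewrite !mulrDr.
apply: le_trans (modulusD_le _ _) _; apply: lerD; last exact: (edge_sum_bound _ cP fM).
by apply: le_trans (modulusD_le _ _) _; apply: lerD; exact: (edge_sum_bound _ cP fM).
Qed.

(** Each midline is an edge of two of the four halves, in opposite directions. *)
Lemma triangle_sum_split f N a b c :
  triangle_sum f N.+1 a b c =
    triangle_sum f N a ((a + b) / 2) ((c + a) / 2) +
    triangle_sum f N ((a + b) / 2) b ((b + c) / 2) +
    triangle_sum f N ((c + a) / 2) ((b + c) / 2) c +
    triangle_sum f N ((b + c) / 2) ((c + a) / 2) ((a + b) / 2).
Proof.
rewrite /triangle_sum /= (edge_sum_sym f N ((c + a) / 2) ((a + b) / 2)).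
rewrite (edge_sum_sym f N ((a + b) / 2) ((b + c) / 2)).
rewrite (edge_sum_sym f N ((b + c) / 2) ((c + a) / 2)).
ring.
Qed.

Lemma triangle_sum_subZ f g (k : C) N a b c :
  triangle_sum (fun t => f t - k * g t) N a b c =
    triangle_sum f N a b c - k * triangle_sum g N a b c.
Proof. by rewrite /triangle_sum !edge_sum_subZ; ring. Qed.

Lemma triangle_sum_affine u v N a b c : triangle_sum (fun t => u + v * t) N a b c = 0.
Proof. by rewrite /triangle_sum !edge_sum_affine; field. Qed.

(** The upper limit of [|triangle_sum f N a b c|] as [N] grows is at most [x].
    Upper limits are all that the bisections need, and they add up. *)
Definition triangle_limsup f a b c x := forall e : R, 0 < e ->
  exists M, forall N, (M <= N)%N -> modulus (triangle_sum f N a b c) <= x + e.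

Lemma triangle_limsup_split f a b c x1 x2 x3 x4 :
  triangle_limsup f a ((a + b) / 2) ((c + a) / 2) x1 ->
  triangle_limsup f ((a + b) / 2) b ((b + c) / 2) x2 ->
  triangle_limsup f ((c + a) / 2) ((b + c) / 2) c x3 ->
  triangle_limsup f ((b + c) / 2) ((c + a) / 2) ((a + b) / 2) x4 ->
  triangle_limsup f a b c (x1 + x2 + x3 + x4).
Proof.
move=> h1 h2 h3 h4 e e0; have e4 : 0 < e / 4 by rewrite divr_gt0.
have [M1 {}h1] := h1 _ e4; have [M2 {}h2] := h2 _ e4.
have [M3 {}h3] := h3 _ e4; have [M4 {}h4] := h4 _ e4.
exists (maxn (maxn M1 M2) (maxn M3 M4)).+1 => -[//|N].
rewrite ltnS !geq_max => /andP[/andP[/h1{}h1 /h2{}h2] /andP[/h3{}h3 /h4{}h4]].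
rewrite triangle_sum_split.
have -> : x1 + x2 + x3 + x4 + e = x1 + e / 4 + (x2 + e / 4) + (x3 + e / 4) + (x4 + e / 4).
  by field.
do 3 (apply: le_trans (modulusD_le _ _) _; apply: lerD => //).
Qed.

Lemma triangle_limsup_bound P f M a b c : midpoint_closed P ->
  (forall t, P t -> modulus (f t) <= M) -> P a -> P b -> P c ->
  triangle_limsup f a b c (M * (modulus (b - a) + modulus (c - b) + modulus (a - c))).
Proof.
move=> cP fM Pa Pb Pc e e0; exists 0%N => N _.
by apply: le_trans (triangle_sum_bound _ cP fM Pa Pb Pc) _; rewrite lerDl ltW.
Qed.

End Trapezoid.

(** * Limits in the complex plane *)

Section Completeness.
Variable R : realType.
Local Notation C := (Cplx R).

Lemma Rcauchy_cvg (T : Type) (F : set_system T) (FF : ProperFilter F) (u : T -> R) :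
  (forall e, 0 < e -> exists x : R, \forall t \near F, `|x - u t| <= e) ->
  cvg (u @ F).
Proof.
move=> H; apply: cauchy_cvg; apply: cauchy_exP => e e0.
have [x Hx] := H _ (divr_gt0 e0 (@ltr0Sn R 1)).
exists x; rewrite /fmap /=; apply: filterS Hx => t /= h.
by rewrite /ball /= (le_lt_trans h)// ltr_pdivrMr// mulr_natr mulr2n ltrDl.
Qed.

Lemma modulus_le_Re_Im (x : C) : modulus x <= `|complex.Re x| + `|complex.Im x|.
Proof.
case: x => a b /=; rewrite -[leRHS]ger0_norm ?addr_ge0// -sqrtr_sqr ler_wsqrtr//.
by rewrite sqrrD !real_normK ?num_real// addrAC lerDl mulrn_wge0 ?mulr_ge0.
Qed.

(** For arbitrary filters, so as to serve both for sequences of points and for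
    difference quotients whose increment tends to 0. *)
Lemma cauchy_limit (T : Type) (F : set_system T) (FF : ProperFilter F) (u : T -> C) :
  (forall e, 0 < e -> exists x : C, \forall t \near F, modulus (x - u t) <= e) ->
  exists l : C, forall e, 0 < e -> \forall t \near F, modulus (l - u t) <= e.
Proof.
move=> H.
have /cvg_ex[/= a Ha] : cvg ((fun t => complex.Re (u t)) @ F).
  apply: Rcauchy_cvg => e /H[x Hx]; exists (complex.Re x); apply: filterS Hx => t /= h.
  by apply: le_trans h; rewrite -raddfB; exact: normr_Re_le_modulus.
have /cvg_ex[/= b Hb] : cvg ((fun t => complex.Im (u t)) @ F).
  apply: Rcauchy_cvg => e /H[x Hx]; exists (complex.Im x); apply: filterS Hx => t /= h.
  by apply: le_trans h; rewrite -raddfB; exact: normr_Im_le_modulus.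
exists (a +i* b)%C => e e0; have e2 : 0 < e / 2 by rewrite divr_gt0.
have /cvgrPdist_le/(_ _ e2) {}Ha := Ha; have /cvgrPdist_le/(_ _ e2) {}Hb := Hb.
apply: filterS2 Ha Hb => t hx hy.
by apply: le_trans (modulus_le_Re_Im _) _; rewrite [e]splitr !raddfB lerD.
Qed.

Lemma geometric_limit (u : nat -> C) (D : R) : 0 <= D ->
  (forall k, modulus (u k.+1 - u k) <= D / 2 ^+ k) ->
  exists z, forall k, modulus (u k - z) <= (D *+ 2) / 2 ^+ k.
Proof.
move=> D0 H.
have H2 k j : modulus (u k - u (k + j)%N) <= D *+ 2 / 2 ^+ k - D *+ 2 / 2 ^+ (k + j).
  elim: j => [|j IH]; first by rewrite addn0 !subrr Normc.normc0.
  apply: le_trans (modulus_triangle _ (u (k + j)%N) _) _.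
  apply: le_trans (lerD IH _) _.
    by rewrite modulus_distC addnS; exact: H.
  by rewrite addnS exprS invfM mulr2n; lra.
have H3 k j : (k <= j)%N -> modulus (u k - u j) <= D *+ 2 / 2 ^+ k.
  move=> /subnKC <-; apply: le_trans (H2 _ _) _.
  by rewrite gerBl divr_ge0 ?exprn_ge0 ?mulrn_wge0.
have [z Hz] : exists l : C, forall e, 0 < e -> \forall t \near \oo, modulus (l - u t) <= e.
  apply: cauchy_limit => e e0.
  have : (D *+ 2) * (2^-1 ^+ k) @[k --> \oo] --> (0 : R).
    rewrite -[X in _ --> X](mulr0 (D *+ 2)); apply: cvgMr.
    by apply: cvg_expr; rewrite ger0_norm// invf_lt1// ltr1n.
  move=> /cvgrPdist_le/(_ _ e0)[k _ Hk]; exists (u k), k => // j kj /=.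
  apply: le_trans (H3 _ _ kj) _; have := Hk k (leqnn k).
  rewrite /= sub0r normrN exprVn; exact: le_trans (ler_norm _).
exists z => k; apply/ler_addgt0Pr => e e0; have [j _ Hj] := Hz _ e0.
pose i := maxn j k.
apply: le_trans (modulus_triangle _ (u i) _) _; apply: lerD.
  by apply: H3; exact: leq_maxr.
by rewrite modulus_distC; apply: Hj; exact: leq_maxl.
Qed.

End Completeness.

(** * Goursat's lemma *)

Section Goursat.
Variable R : realType.
Local Notation C := (Cplx R).
Implicit Types (f : C -> C) (P : C -> Prop).

Definition perimeter (a b c : C) : R := modulus (b - a) + modulus (c - b) + modulus (a - c).

Lemma triangle_limsup_le f (a b c : C) (x y : R) : x <= y ->
  triangle_limsup f a b c x -> triangle_limsup f a b c y.
Proof.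
move=> xy H e /H[M {}H]; exists M => N /H h; apply: le_trans h _; exact: lerD.
Qed.

(** What bisection has to know about [T'] being one of the four triangles that the
    midlines cut out of [T]. *)
Definition is_half P (T T' : C * C * C) :=
  let: (a, b, c) := T in let: (a', b', c') := T' in
  [/\ P a -> P b -> P c -> [/\ P a', P b' & P c'],
      perimeter a' b' c' = perimeter a b c / 2 &
      modulus (a' - a) <= perimeter a b c].

Lemma midpoints_perimeter (a b c : C) :
  [/\ perimeter a ((a + b) / 2) ((c + a) / 2) = perimeter a b c / 2,
      perimeter ((a + b) / 2) b ((b + c) / 2) = perimeter a b c / 2,
      perimeter ((c + a) / 2) ((b + c) / 2) c = perimeter a b c / 2 &
      perimeter ((b + c) / 2) ((c + a) / 2) ((a + b) / 2) = perimeter a b c / 2].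
Proof.
rewrite /perimeter !mulrDl -!modulus_half.
by split; (congr (_ + _ + _);
  first [congr modulus; field | rewrite modulus_distC; congr modulus; field]).
Qed.

Lemma vertex_dist_perimeter (a b c : C) :
  [/\ modulus (b - a) <= perimeter a b c, modulus (c - a) <= perimeter a b c &
      modulus ((b + c) / 2 - a) <= perimeter a b c].
Proof.
have hb : modulus (b - a) <= perimeter a b c.
  by rewrite /perimeter -addrA lerDl addr_ge0 ?modulus_ge0.
have hc : modulus (c - a) <= perimeter a b c.
  by rewrite /perimeter modulus_distC lerDr addr_ge0 ?modulus_ge0.
split=> //; have -> : (b + c) / 2 - a = ((b - a) + (c - a)) / 2 by field.
by rewrite modulus_half ler_pdivrMr//; apply: le_trans (modulusD_le _ _) _; lra.
Qed.

Lemma perimeter_ge0 (a b c : C) : 0 <= perimeter a b c.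
Proof. by rewrite !addr_ge0 ?modulus_ge0. Qed.

Lemma triangle_limsup_half f P a b c x : midpoint_closed P -> ~ triangle_limsup f a b c x ->
  exists2 T, is_half P (a, b, c) T & ~ triangle_limsup f T.1.1 T.1.2 T.2 (x / 4).
Proof.
move=> cP bad; apply: contrapT => good; apply: bad.
have -> : x = x / 4 + x / 4 + x / 4 + x / 4 by field.
have [p1 p2 p3 p4] := midpoints_perimeter a b c.
have [h1 h2 h3] := vertex_dist_perimeter a b c.
have pge := perimeter_ge0 a b c.
have hab : modulus ((a + b) / 2 - a) <= perimeter a b c.
  have -> : (a + b) / 2 - a = (b - a) / 2 by field.
  by rewrite modulus_half; lra.
have hca : modulus ((c + a) / 2 - a) <= perimeter a b c.
  have -> : (c + a) / 2 - a = (c - a) / 2 by field.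
  by rewrite modulus_half; lra.
apply: triangle_limsup_split; apply: contrapT => bad; apply: good.
- exists (a, (a + b) / 2, (c + a) / 2) => //.
  by split=> //; [move=> Pa Pb Pc; split => //; exact: cP|rewrite subrr Normc.normc0].
- exists ((a + b) / 2, b, (b + c) / 2) => //.
  by split=> // Pa Pb Pc; split => //; exact: cP.
- exists ((c + a) / 2, (b + c) / 2, c) => //.
  by split=> // Pa Pb Pc; split => //; exact: cP.
- exists ((b + c) / 2, (c + a) / 2, (a + b) / 2) => //.
  by split=> // Pa Pb Pc; split => //; exact: cP.
Qed.

Lemma ball_midpoint_closed (z : C) (r : R) :
  midpoint_closed (fun t => modulus (t - z) <= r).
Proof.
move=> p q hp hq; have -> : (p + q) / 2 - z = ((p - z) + (q - z)) / 2 by field.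
by rewrite modulus_half ler_pdivrMr//; apply: le_trans (modulusD_le _ _) _; lra.
Qed.

(** Bisection. If the sums of a triangle exceed [x] for arbitrarily large [N], then
    those of one of its halves exceed [x / 4]. The nested triangles so obtained
    shrink to a point [z] of [P]; the sums of the affine approximation of [f] at [z]
    vanish, and its error contributes at most [x / 4 ^ k] to the [k]-th triangle. *)
Theorem goursat f P (a b c : C) : midpoint_closed P ->
  (forall z, (forall e : R, 0 < e -> exists2 p, P p & modulus (p - z) <= e) -> P z) ->
  (forall z, P z -> derivable f z 1) -> P a -> P b -> P c ->
  triangle_limsup f a b c 0.
Proof.
move=> cP clP df Pa Pb Pc.
suff H x : 0 < x -> triangle_limsup f a b c x.
  move=> e e0; have e2 : 0 < e / 2 by rewrite divr_gt0.
  have [M HM] := H _ e2 _ e2; exists M => N /HM.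
  by rewrite add0r -splitr.
move=> x0; apply: contrapT => bad.
have /choice[next Hnext] : forall S : R * (C * C * C), exists T,
    ~ triangle_limsup f S.2.1.1 S.2.1.2 S.2.2 S.1 ->
    is_half P S.2 T /\ ~ triangle_limsup f T.1.1 T.1.2 T.2 (S.1 / 4).
  move=> [y [[a' b'] c']] /=.
  have [good|/(triangle_limsup_half cP)[T h1 h2]] := pselect (triangle_limsup f a' b' c' y).
    by exists (a', b', c').
  by exists T.
pose S k := iter k (fun S => (S.1 / 4, next S)) (x, (a, b, c)).
have Sx k : (S k).1 = x / 4 ^+ k.
  by elim: k => [|k IH]; rewrite ?expr0 ?divr1//= IH exprSr invfM mulrA.
pose T k := (S k).2.
have badT k : ~ triangle_limsup f (T k).1.1 (T k).1.2 (T k).2 (x / 4 ^+ k).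
  elim: k => [|k IH]; first by rewrite expr0 divr1.
  rewrite exprSr invfM mulrA -Sx; rewrite -Sx in IH.
  by have [_] := Hnext (S k) IH.
have halfT k : is_half P (T k) (T k.+1).
  by have := badT k; rewrite -Sx => /Hnext[].
pose D := perimeter a b c.
have perT k : perimeter (T k).1.1 (T k).1.2 (T k).2 = D / 2 ^+ k.
  elim: k => [|k IH]; first by rewrite expr0 divr1.
  move: (halfT k) IH; case: (T k) => [[a1 b1] c1]; case: (T k.+1) => [[a2 b2] c2] /=.
  by move=> [_ -> _] ->; rewrite exprSr invfM mulrA.
have PT k : [/\ P (T k).1.1, P (T k).1.2 & P (T k).2].
  elim: k => [|k]; first by split.
  move: (halfT k); case: (T k) => [[a1 b1] c1]; case: (T k.+1) => [[a2 b2] c2] /=.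
  by move=> [h _ _] [? ? ?]; apply: h.
have [z Hz] : exists z, forall k, modulus ((T k).1.1 - z) <= (D *+ 2) / 2 ^+ k.
  apply: (@geometric_limit R (fun k => (T k).1.1)); first exact: perimeter_ge0.
  move=> k; move: (halfT k) (perT k).
  case: (T k) => [[a1 b1] c1]; case: (T k.+1) => [[a2 b2] c2] /=.
  by move=> [_ _ h] <-.
have D0 : 0 <= D by exact: perimeter_ge0.
have small e : 0 < e -> exists k, D *+ 3 / 2 ^+ k <= e.
  move=> e0; have : (D *+ 3) * (2^-1 ^+ k) @[k --> \oo] --> (0 : R).
    rewrite -[X in _ --> X](mulr0 (D *+ 3)); apply: cvgMr.
    by apply: cvg_expr; rewrite ger0_norm// invf_lt1// ltr1n.
  move=> /cvgrPdist_le/(_ _ e0)[k _ Hk]; exists k; have := Hk k (leqnn k).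
  rewrite /= sub0r normrN exprVn; exact: le_trans (ler_norm _).
have Pz : P z.
  apply: clP => e /small[k Hk]; exists (T k).1.1; first by have [] := PT k.
  apply: le_trans (Hz k) (le_trans _ Hk).
  by rewrite ler_wpM2r ?invr_ge0 ?exprn_ge0// -!(mulr_natr D) ler_wpM2l// ler_nat.
have /derivable_has_derivP[l Hl] := df _ Pz.
(* The [k]-th triangle has perimeter [D / 2 ^ k] and lies within three times that
   distance of [z], so that errors of slope [e] need [3 e D ^ 2 <= x]. *)
have e0 : 0 < x / (D ^+ 2 *+ 3 + 1).
  by rewrite divr_gt0// ltr_wpDl// mulrn_wge0 ?exprn_ge0.
set e := x / _ in e0; have [d d0 {}Hl] := Hl _ e0.
have d2 : 0 < d / 2 by rewrite divr_gt0.
have [k Hk] := small _ d2; apply: (badT k).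
case E : (T k) (perT k) (Hz k) => [[a1 b1] c1] /=; set r := D / 2 ^+ k => per az.
pose g t := f t - 1 * ((f z - l * z) + l * t).
have trig N : triangle_sum f N a1 b1 c1 = triangle_sum g N a1 b1 c1.
  by rewrite triangle_sum_subZ triangle_sum_affine mulr0 subr0.
have r0 : 0 <= r by rewrite divr_ge0 ?exprn_ge0.
have gbd t : modulus (t - a1) <= r -> modulus (g t) <= e * (r *+ 3).
  move=> ta; have tz : modulus (t - z) <= r *+ 3.
    apply: le_trans (modulus_triangle _ a1 _) _; rewrite [r *+ 3]mulrS lerD//.
    by rewrite /r -mulrnAl.
  have -> : g t = f (z + (t - z)) - f z - l * (t - z).
    by rewrite [z + (t - z)]addrC subrK /g; ring.
  apply: le_trans (Hl _ _) _; last by rewrite ler_wpM2l// ltW.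
  apply: le_lt_trans tz _; rewrite /r -mulrnAl; apply: le_lt_trans Hk _.
  by rewrite ltr_pdivrMr// mulr_natr mulr2n ltrDl.
have [v1 v2 _] := vertex_dist_perimeter a1 b1 c1; rewrite per in v1 v2.
have v0 : modulus (a1 - a1) <= r by rewrite subrr Normc.normc0.
have H := triangle_limsup_bound (@ball_midpoint_closed a1 r) gbd v0 v1 v2.
suff : triangle_limsup g a1 b1 c1 (x / 4 ^+ k).
  by move=> H' eta /H'[M HM]; exists M => N /HM; rewrite trig.
apply: triangle_limsup_le H; rewrite -/(perimeter a1 b1 c1) per.
have -> : (4 : R) ^+ k = 2 ^+ k * 2 ^+ k by rewrite -exprMn -natrM.
have -> : e * (r *+ 3) * r = (x / (2 ^+ k * 2 ^+ k)) * ((D ^+ 2 *+ 3) / (D ^+ 2 *+ 3 + 1)).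
  have n1 : D ^+ 2 *+ 3 + 1 != 0 by rewrite gt_eqF// ltr_wpDl// mulrn_wge0 ?exprn_ge0.
  have n2 : (2 : R) ^+ k != 0 by rewrite expf_neq0.
  rewrite /e /r; move: n1 n2; move: (2 ^+ k) (D ^+ 2 *+ 3 + 1) => y w n1 n2.
  by field; rewrite n1 n2.
apply: ler_piMr; first by rewrite divr_ge0 ?ltW// mulr_gt0 ?exprn_gt0.
by rewrite ler_pdivrMr ?mul1r ?lerDl// ltr_wpDl// mulrn_wge0 ?exprn_ge0.
Qed.

End Goursat.

(** * Cauchy's formula as an inequality *)

Section MaximumModulus.
Variable R : realType.
Local Notation C := (Cplx R).
Implicit Types (f h : C -> C) (l p q z : C).

Lemma Re_half (x : C) : complex.Re (x / 2) = complex.Re x / 2.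
Proof.
have -> : x / 2 = (2^-1 : R)%:C%C * x.
  by rewrite mulrC fmorphV rmorph_nat.
by case: x => a b /=; rewrite mul0r subr0 mulrC.
Qed.

Lemma Im_half (x : C) : complex.Im (x / 2) = complex.Im x / 2.
Proof.
have -> : x / 2 = (2^-1 : R)%:C%C * x.
  by rewrite mulrC fmorphV rmorph_nat.
by case: x => a b /=; rewrite mul0r addr0 mulrC.
Qed.

Lemma halfplane_midpoint_closed l (s : R) :
  midpoint_closed (fun t : C => s <= complex.Re (l * t)).
Proof.
move=> p q hp hq; rewrite mulrA Re_half mulrDr raddfD /= ler_pdivlMr//.
by rewrite mulr_natr mulr2n lerD.
Qed.

Lemma halfplane_closed l (s : R) z :
  (forall e : R, 0 < e -> exists2 p, s <= complex.Re (l * p) & modulus (p - z) <= e) ->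
  s <= complex.Re (l * z).
Proof.
move=> H; apply/ler_addgt0Pr => e e0.
have l1 : 0 < modulus l + 1 by rewrite ltr_wpDl ?modulus_ge0.
have [p hp pz] := H _ (divr_gt0 e0 l1).
apply: le_trans hp _; rewrite -(subrK z p) mulrDr raddfD /= addrC lerD2l.
apply: le_trans (Re_le_modulus _) _; rewrite Normc.normcM.
apply: le_trans (ler_wpM2l (modulus_ge0 _) pz) _.
by rewrite mulrCA ger_pMr// ler_pdivrMr// mul1r lerDl.
Qed.

(** Of the four halves of a triangle with a vertex at 0, only the one at that
    vertex is out of reach of [goursat]; it shrinks to a point where [h] is
    bounded. *)
Lemma corner_limsup h l (M rho : R) : (forall t, t != 0 -> derivable h t 1) ->
  (forall t, modulus t <= rho -> modulus (h t) <= M) ->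
  forall k b c, 0 < complex.Re (l * b) -> 0 < complex.Re (l * c) ->
    modulus b <= rho * 2 ^+ k -> modulus c <= rho * 2 ^+ k ->
  triangle_limsup h 0 b c (M * perimeter 0 b c / 2 ^+ k).
Proof.
move=> dh hM; elim=> [|k IH] b c b0 c0 hb hc.
  rewrite expr0 mulr1 in hb hc *; rewrite divr1.
  have hM' t : modulus (t - 0) <= rho -> modulus (h t) <= M.
    by rewrite subr0; exact: hM.
  apply: (triangle_limsup_bound (@ball_midpoint_closed _ 0 rho) hM'); rewrite ?subr0//.
  by rewrite Normc.normc0; apply: le_trans hb; exact: modulus_ge0.
pose s := Num.min (complex.Re (l * b)) (complex.Re (l * c)) / 2.
have s0 : 0 < s by rewrite divr_gt0// lt_min b0.
have sb2 : s <= complex.Re (l * b) / 2 by rewrite ler_pM2r// ge_min lexx.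
have sc2 : s <= complex.Re (l * c) / 2 by rewrite ler_pM2r// ge_min lexx orbT.
have [p0 _ _ _] := midpoints_perimeter 0 b c.
have -> : M * perimeter 0 b c / 2 ^+ k.+1 =
    M * perimeter 0 ((0 + b) / 2) ((c + 0) / 2) / 2 ^+ k + 0 + 0 + 0.
  by rewrite p0 exprS invfM; ring.
have Pb2 : s <= complex.Re (l * ((0 + b) / 2)) by rewrite add0r mulrA Re_half.
have Pc2 : s <= complex.Re (l * ((c + 0) / 2)) by rewrite addr0 mulrA Re_half.
have Pb : s <= complex.Re (l * b) by lra.
have Pc : s <= complex.Re (l * c) by lra.
have Pbc := halfplane_midpoint_closed Pb Pc.
have good := @goursat R h _ _ _ _ (@halfplane_midpoint_closed l s)
  (@halfplane_closed l s).
have dP z : s <= complex.Re (l * z) -> derivable h z 1.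
  move=> sz; apply: dh; apply: contraTneq sz => ->.
  by rewrite mulr0 /= -ltNge.
apply: triangle_limsup_split; try exact: good.
apply: IH.
- by apply: lt_le_trans s0 _.
- by apply: lt_le_trans s0 _.
- by rewrite add0r modulus_half ler_pdivrMr// -mulrA -exprSr.
- by rewrite addr0 modulus_half ler_pdivrMr// -mulrA -exprSr.
Qed.

(** Twice the oriented area of the triangle with vertices 0, [p] and [q]. *)
Definition cross p q : R := complex.Re p * complex.Im q - complex.Im p * complex.Re q.

(** The imaginary part of [dt / t] along a segment is the angle seen from 0,
    at least twice the area of the triangle inside the unit disc. *)
Lemma cross_le_edge_sum_inv N p q : modulus p <= 1 -> modulus q <= 1 -> 0 <= cross p q ->
  cross p q <= complex.Im (edge_sum (fun t => t^-1) N p q).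
Proof.
elim: N p q => [|N IH] p q p1 q1 pq; last first.
  rewrite [edge_sum _ _ _ _]/= raddfD /=.
  have hm : cross p ((p + q) / 2) = cross p q / 2.
    by rewrite /cross Re_half Im_half !raddfD /=; field.
  have mh : cross ((p + q) / 2) q = cross p q / 2.
    by rewrite /cross Re_half Im_half !raddfD /=; field.
  have m1 : modulus ((p + q) / 2) <= 1.
    by rewrite modulus_half; apply: le_trans (_ : (1 + 1) / 2 <= 1); [|lra];
      rewrite ler_pM2r ?invr_gt0//; apply: le_trans (modulusD_le _ _) _; exact: lerD.
  have pq2 : 0 <= cross p q / 2 by rewrite divr_ge0.
  have := IH _ _ p1 m1; have := IH _ _ m1 q1; rewrite hm mh => /(_ pq2) h1 /(_ pq2) h2.
  by rewrite [cross p q]splitr lerD.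
have -> : edge_sum (fun t : C => t^-1) 0 p q = (p^-1 * (q - p) + q^-1 * (q - p)) / 2.
  by rewrite /=; ring.
have sqrt1 (a b : R) : Num.sqrt (a ^+ 2 + b ^+ 2) <= 1 -> a ^+ 2 + b ^+ 2 <= 1.
  move=> ab; rewrite -[leLHS]sqr_sqrtr ?addr_ge0 ?sqr_ge0//.
  by rewrite expr_le1.
(* Since [0^-1 = 0], a vertex at 0 is harmless: it makes the area vanish too. *)
have le_div (x a b : R) : 0 <= x -> Num.sqrt (a ^+ 2 + b ^+ 2) <= 1 ->
    (a = 0 -> b = 0 -> x = 0) -> x <= x / (a ^+ 2 + b ^+ 2).
  move=> x0 /sqrt1; have [] := eqVneq (a ^+ 2 + b ^+ 2) 0 => [ab _ H|ab ab1 _].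
    have : (a == 0) && (b == 0).
      by rewrite -(sqrf_eq0 a) -(sqrf_eq0 b) -paddr_eq0 ?sqr_ge0// ab.
    by move=> /andP[/eqP a0 /eqP b0]; rewrite H// mul0r.
  have n0 : 0 < a ^+ 2 + b ^+ 2 by rewrite lt_neqAle eq_sym ab addr_ge0 ?sqr_ge0.
  by rewrite ler_pdivlMr// ler_piMr.
rewrite Im_half raddfD /= ler_pdivlMr// mulr_natr mulr2n.
move: p q p1 q1 pq => [a b] [c d] /= p1 q1; rewrite /cross /= => pq.
apply: lerD.
  apply: le_trans (le_div _ _ _ pq p1 _) _ => [-> -> |]; first by ring.
  by rewrite le_eqVlt; apply/orP; left; apply/eqP; ring.
apply: le_trans (le_div _ _ _ pq q1 _) _ => [-> -> |]; first by ring.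
by rewrite le_eqVlt; apply/orP; left; apply/eqP; ring.
Qed.

Definition quarter_turn p : C := (- complex.Im p +i* complex.Re p)%C.

(** For [p] on the unit circle, the line through [p] and ['i * p] consists of the
    [t] with [Re (side_normal p * t) = 1]; it stays at distance at least 1/2 from 0. *)
Definition side_normal p : C :=
  ((complex.Re p - complex.Im p) +i* (- (complex.Re p + complex.Im p)))%C.

Lemma sqr_modulus1 p : modulus p = 1 -> complex.Re p ^+ 2 + complex.Im p ^+ 2 = 1.
Proof.
case: p => a b /= ab; rewrite -[LHS]sqr_sqrtr ?addr_ge0 ?sqr_ge0//.
by rewrite ab expr1n.
Qed.

Lemma modulus_quarter_turn p : modulus (quarter_turn p) = modulus p.
Proof. by case: p => a b /=; rewrite sqrrN addrC. Qed.

Lemma side_normalP p : modulus p = 1 ->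
  [/\ complex.Re (side_normal p * p) = 1, complex.Re (side_normal p * quarter_turn p) = 1,
      modulus (side_normal p) <= 2 & cross p (quarter_turn p) = 1].
Proof.
move=> /sqr_modulus1 H; split.
- by rewrite -[RHS]H; case: (p) => a b /=; ring.
- by rewrite -[RHS]H; case: (p) => a b /=; ring.
- have -> : 2 = Num.sqrt (2 ^+ 2) :> R by rewrite sqrtr_sqr ger0_norm.
  rewrite ler_wsqrtr//.
  by move: H; case: (p) => a b /=; nra.
- by rewrite -[RHS]H; case: (p) => a b /=; rewrite /cross /=; ring.
Qed.

(** The bound of [corner_limsup] tends to 0 as [k] grows, whatever the size of the
    triangle. *)
Lemma corner_vanish h l b c (M rho : R) : (forall t, t != 0 -> derivable h t 1) ->
  0 < rho -> (forall t, modulus t <= rho -> modulus (h t) <= M) ->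
  0 < complex.Re (l * b) -> 0 < complex.Re (l * c) -> triangle_limsup h 0 b c 0.
Proof.
move=> dh rho0 hM b0 c0 e e0; have e2 : 0 < e / 2 by rewrite divr_gt0.
pose y := (`|M * perimeter 0 b c| + 1) / (e / 2).
pose x := (modulus b + modulus c) / rho.
have y0 : 0 <= y by apply: divr_ge0; rewrite ?addr_ge0// ltW.
have x0 : 0 <= x.
  by apply: divr_ge0; [apply: addr_ge0; exact: modulus_ge0|exact: ltW].
have [k Hk] : exists k, y + x <= 2 ^+ k.
  have [k Hk] : exists k : nat, y + x <= k%:R.
    by exists (Num.bound (y + x)); apply: ltW; apply: archi_boundP; rewrite addr_ge0.
  exists k; apply: le_trans Hk _.
  by rewrite -natrX ler_nat ltnW// ltn_expl.
have xk : modulus b + modulus c <= rho * 2 ^+ k.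
  by rewrite mulrC -ler_pdivrMr// (le_trans _ Hk)// lerDr.
have hb : modulus b <= rho * 2 ^+ k by apply: le_trans xk; rewrite lerDl modulus_ge0.
have hc : modulus c <= rho * 2 ^+ k by apply: le_trans xk; rewrite lerDr modulus_ge0.
have [N HN] := corner_limsup dh hM b0 c0 hb hc e2.
exists N => n /HN /le_trans; apply; rewrite add0r [leRHS]splitr lerD2r.
rewrite ler_pdivrMr ?exprn_gt0//; apply: le_trans (ler_norm _) _.
have yk : y <= 2 ^+ k by apply: le_trans Hk; rewrite lerDl.
apply: le_trans (_ : e / 2 * y <= _); last by rewrite ler_pM2l.
by rewrite /y [leRHS]mulrC divfK ?gt_eqF// lerDl.
Qed.

(** Cauchy's formula on the square whose vertices are the fourth roots of unity:
    the trapezoid sums of [(f t - f 0) / t] around the square tend to 0, whereas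
    the imaginary part of those of [1 / t] is at least 4, twice the area of the
    square. *)
Lemma center_bound f (M : R) : (forall z, derivable f z 1) ->
  (forall t, 1 / 2 <= modulus t <= 1 -> modulus (f t) <= M) ->
  modulus (f 0) <= 4 * M.
Proof.
move=> df fM; pose h t : C := (f t - f 0) / t.
have dh t : t != 0 -> derivable h t 1.
  move=> t0; have := @derivable_div R 0 (fun t => f t - f 0 : C) t t0
    (derivable_sub (df t) (@derivable_cst _ _ _ _ _ _)).
  by congr (derivable _ t 1); apply/funext => u; rewrite subr0.
have [l /(_ 1 ltr01)[d d0 Hd]] := (derivable_has_derivP f 0).1 (df 0).
have hB t : modulus t <= d / 2 -> modulus (h t) <= modulus l + 1.
  move=> td; rewrite /h; have [->|t0] := eqVneq t 0.
    by rewrite invr0 mulr0 Normc.normc0 addr_ge0 ?modulus_ge0.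
  have := Hd t; rewrite add0r mul1r => H.
  rewrite modulus_div ler_pdivrMr ?modulus_gt0//.
  rewrite -[f t - f 0](subrK (l * t)); apply: le_trans (modulusD_le _ _) _.
  rewrite addrC Normc.normcM mulrDl mul1r lerD2l; apply: H.
  by apply: le_lt_trans td _; rewrite ltr_pdivrMr// mulr_natr mulr2n ltrDl.
have side p : modulus p = 1 -> triangle_limsup h 0 p (quarter_turn p) 0.
  move=> p1; have [h1 h2 _ _] := side_normalP p1.
  have d2 : 0 < d / 2 by rewrite divr_gt0.
  by apply: (corner_vanish dh d2 hB (l := side_normal p)); rewrite ?h1 ?h2.
have side_bound N p : modulus p = 1 ->
    modulus (edge_sum (fun t => f t * t^-1) N p (quarter_turn p)) <= 4 * M.
  move=> p1; have [h1 h2 h3 _] := side_normalP p1.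
  pose P t := 1 <= complex.Re (side_normal p * t) /\ modulus (t - 0) <= 1.
  have cP : midpoint_closed P.
    move=> u v [u1 u2] [v1 v2]; split; first exact: halfplane_midpoint_closed.
    exact: ball_midpoint_closed.
  have fP t : P t -> modulus (f t * t^-1) <= 2 * M.
    move=> [t1]; rewrite subr0 => t2.
    have t3 : 1 / 2 <= modulus t.
      rewrite ler_pdivrMr// mulrC; apply: le_trans t1 _.
      apply: le_trans (Re_le_modulus _) _; rewrite Normc.normcM.
      by rewrite ler_wpM2r ?modulus_ge0.
    have t4 : 0 < modulus t by apply: lt_le_trans t3; rewrite divr_gt0.
    have ft := fM t; rewrite t3 t2 in ft; have {}ft := ft erefl.
    rewrite Normc.normcM Normc.normcV ler_pdivrMr//.
    have := modulus_ge0 (f t); nra.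
  have Pp : P p by rewrite /P h1 subr0 p1.
  have Pq : P (quarter_turn p) by rewrite /P h2 subr0 modulus_quarter_turn p1.
  apply: le_trans (edge_sum_bound N cP fP Pp Pq) _.
  have M0 : 0 <= M.
    apply: le_trans (fM p _); first exact: modulus_ge0.
    by rewrite p1 lexx andbT; lra.
  have : modulus (quarter_turn p - p) <= 2.
    by apply: le_trans (modulusB_le _ _) _; rewrite modulus_quarter_turn p1.
  by nra.
have invside N p : modulus p = 1 ->
    1 <= complex.Im (edge_sum (fun t => t^-1) N p (quarter_turn p)).
  move=> p1; have [_ _ _ h4] := side_normalP p1.
  by rewrite -[leLHS]h4 cross_le_edge_sum_inv ?modulus_quarter_turn ?p1// h4.
pose p0 : C := 1; pose p1 := quarter_turn p0.
pose p2 := quarter_turn p1; pose p3 := quarter_turn p2.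
have p01 : modulus p0 = 1 by rewrite Normc.normc1.
have p11 : modulus p1 = 1 by rewrite modulus_quarter_turn.
have p21 : modulus p2 = 1 by rewrite modulus_quarter_turn.
have p31 : modulus p3 = 1 by rewrite modulus_quarter_turn.
have p40 : quarter_turn p3 = p0.
  by rewrite /p3 /p2 /p1 /p0 /quarter_turn /= !opprK.
apply/ler_addgt0Pr => e e0.
have [N0 H0] := side _ p01 _ e0; have [N1 H1] := side _ p11 _ e0.
have [N2 H2] := side _ p21 _ e0; have [N3 H3] := side _ p31 _ e0.
pose N := (N0 + N1 + N2 + N3)%N.
have {}H0 := H0 N; have {}H1 := H1 N; have {}H2 := H2 N; have {}H3 := H3 N.
have {}H0 : modulus (triangle_sum h N 0 p0 p1) <= e.
  by rewrite -[leRHS]add0r; apply: H0; rewrite /N -!addnA leq_addr.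
have {}H1 : modulus (triangle_sum h N 0 p1 p2) <= e.
  by rewrite -[leRHS]add0r; apply: H1; rewrite /N -addnA addnAC leq_addl.
have {}H2 : modulus (triangle_sum h N 0 p2 p3) <= e.
  by rewrite -[leRHS]add0r; apply: H2; rewrite /N -addnA addnCA leq_addr.
have {}H3 : modulus (triangle_sum h N 0 p3 p0) <= e.
  by rewrite -[leRHS]add0r -p40; apply: H3; rewrite /N leq_addl.
pose sq g := edge_sum g N p0 p1 + edge_sum g N p1 p2 +
  edge_sum g N p2 p3 + edge_sum g N p3 p0.
(* The segments from 0 to the vertices cancel out. *)
have hsq : sq h = triangle_sum h N 0 p0 p1 + triangle_sum h N 0 p1 p2 +
    triangle_sum h N 0 p2 p3 + triangle_sum h N 0 p3 p0.
  rewrite /sq /triangle_sum !(edge_sum_sym h N 0); ring.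
have hE : sq h = sq (fun t => f t * t^-1) - f 0 * sq (fun t => t^-1).
  have -> : h = fun t => f t * t^-1 - f 0 * t^-1.
    by apply/funext => t; rewrite /h mulrBl.
  by rewrite /sq !edge_sum_subZ; ring.
have hle : modulus (sq h) <= 4 * e.
  rewrite hsq; apply: le_trans (_ : e + e + e + e <= _); last by lra.
  by do 3 (apply: le_trans (modulusD_le _ _) _; apply: lerD => //).
have fle : modulus (sq (fun t => f t * t^-1)) <= 16 * M.
  apply: le_trans (_ : 4 * M + 4 * M + 4 * M + 4 * M <= _); last by lra.
  rewrite /sq -[X in edge_sum _ _ p3 X]p40.
  by do 3 (apply: le_trans (modulusD_le _ _) _; apply: lerD; last exact: side_bound);
    exact: side_bound.
have invle : 4 <= modulus (sq (fun t => t^-1)).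
  apply: le_trans (Im_le_modulus _); rewrite /sq !raddfD /=.
  have := invside N _ p01; have := invside N _ p11.
  have := invside N _ p21; have := invside N _ p31; rewrite p40.
  rewrite -/p1 -/p2 -/p3; lra.
have : modulus (f 0) * modulus (sq (fun t => t^-1)) <= 16 * M + 4 * e.
  rewrite -Normc.normcM.
  have -> : f 0 * sq (fun t => t^-1) = sq (fun t => f t * t^-1) - sq h.
    by rewrite hE; ring.
  by apply: le_trans (modulusB_le _ _) _; exact: lerD.
have := modulus_ge0 (f 0); nra.
Qed.

End MaximumModulus.

(** * The maximum principle with exceptional points *)

Section RemovableSingularities.
Variable R : realType.
Local Notation C := (Cplx R).
Implicit Types (f G : C -> C) (z : C).

Lemma center_bound_scaled f z (r M : R) : 0 < r -> (forall z, derivable f z 1) ->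
  (forall t, r / 2 <= modulus (t - z) <= r -> modulus (f t) <= M) ->
  modulus (f z) <= 4 * M.
Proof.
move=> r0 df fM; have := @center_bound R (fun s => f (z + r%:C%C * s)) M.
rewrite mulr0 addr0; apply=> [t|t]; first exact: derivable_affine.
move=> /andP[t1 t2]; apply: fM.
rewrite addrC addKr Normc.normcM (modulus_nneg (ltW r0)); apply/andP; split; nra.
Qed.

(** Otherwise, by Bernoulli's inequality, the powers of [a / b] would outgrow any
    constant; [b] is first replaced by the positive mean of [a] and [b]. *)
Lemma le_of_powers (a b c K : R) : 0 < c -> 0 <= b ->
  (forall n, c * a ^+ n <= K * b ^+ n) -> a <= b.
Proof.
move=> c0 b0 H; rewrite leNgt; apply/negP => ba.
pose m := (a + b) / 2; have am : m < a by rewrite /m; lra.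
have mb : b < m by rewrite /m; lra.
have m0 : 0 < m by apply: le_lt_trans mb.
have K0 : 0 <= K by have := H 0%N; rewrite !expr0 !mulr1 => /(le_trans (ltW c0)).
pose x := a / m; have x1 : 1 < x by rewrite ltr_pdivlMr// mul1r.
pose d := x - 1; have d0 : 0 < d by rewrite subr_gt0.
have bern n : 1 + n%:R * d <= x ^+ n.
  elim: n => [|n IH]; first by rewrite expr0 mul0r addr0.
  rewrite exprS; apply: le_trans (_ : x * (1 + n%:R * d) <= _); last first.
    by rewrite ler_pM2l//; lra.
  have -> : x = 1 + d by rewrite /d; ring.
  rewrite -natr1; have : 0 <= n%:R * d * d by rewrite !mulr_ge0// ltW.
  lra.
have Hx n : c * x ^+ n <= K.
  have mn : 0 < m ^+ n by rewrite exprn_gt0.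
  rewrite /x expr_div_n mulrA ler_pdivrMr//; apply: le_trans (H n) _.
  by rewrite ler_wpM2l// lerXn2r ?nnegrE// ltW.
pose n := Num.bound (K / (c * d)).
have : K / (c * d) < n%:R by apply: archi_boundP; rewrite divr_ge0// ltW// mulr_gt0.
rewrite ltr_pdivrMr ?mulr_gt0// => Kn.
by have := Hx n; have := bern n; nra.
Qed.

Lemma avoid_seq (A : seq C) z : exists2 m : R, 0 < m &
  forall h, h != 0 -> modulus h < m -> z + h \notin A.
Proof.
elim: A => [|a A [m m0 IH]]; first by exists 1.
have [az|az] := eqVneq a z.
  exists m => // h h0 /(IH h h0) hA; rewrite inE negb_or hA andbT az.
  by rewrite -subr_eq0 addrAC subrr add0r.
exists (Num.min m (modulus (a - z))) => [|h h0].
  by rewrite lt_min m0 modulus_gt0// subr_eq0.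
rewrite lt_min => /andP[/(IH h h0) hA hz]; rewrite inE negb_or hA andbT.
by apply: contraTneq hz => <-; rewrite addrC addKr ltxx.
Qed.

Definition prod_subr (A : seq C) (t : C) : C := \prod_(a <- A) (t - a).

Lemma derivable_prod_subr (A : seq C) z : derivable (prod_subr A) z 1.
Proof.
elim: A => [|b A IH].
  have -> : prod_subr [::] = fun=> 1 by apply/funext => t; exact: big_nil.
  exact: derivable_cst.
have -> : prod_subr (b :: A) = fun t => (t - b) * prod_subr A t.
  by apply/funext => t; exact: big_cons.
by apply: derivable_mul IH; exact: derivable_subr.
Qed.

(** The high powers of [G] make both the constant of [center_bound_scaled] and
    the polynomial that removes the exceptional points negligible. *)
Lemma max_modulus_off G (A : seq C) z (r M : R) : 0 < r ->
  (forall t, {for t, continuous G}) -> (forall t, t \notin A -> derivable G t 1) ->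
  z \notin A -> (forall t, r / 2 <= modulus (t - z) <= r -> modulus (G t) <= M) ->
  modulus (G z) <= M.
Proof.
move=> r0 cG dG zA GM; pose pi := prod_subr A.
have M0 : 0 <= M.
  apply: le_trans (GM (z + r%:C%C) _); first exact: modulus_ge0.
  by rewrite addrC addKr (modulus_nneg (ltW r0)); apply/andP; split; lra.
pose L := \prod_(a <- A) (modulus (z - a) + r).
have piL t : modulus (t - z) <= r -> modulus (pi t) <= L.
  move=> tz; rewrite /pi /L /prod_subr; elim: (A) => [|a A' IH].
    by rewrite !big_nil Normc.normc1.
  rewrite !big_cons Normc.normcM ler_pM ?modulus_ge0// [leRHS]addrC.
  by apply: le_trans (modulus_triangle _ z _) _; rewrite lerD2r.
have pz : 0 < modulus (pi z).
  by apply: modulus_gt0; rewrite /pi /prod_subr prodf_seq_neq0; apply/allP => a aA /=;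
    rewrite subr_eq0; apply: contraNneq zA => ->.
apply: (@le_of_powers _ _ _ (4 * L) pz M0) => n.
rewrite -modulusX -Normc.normcM -mulrA.
have cb := @center_bound_scaled (fun t : C => pi t * G t ^+ n : C) z r (L * M ^+ n) r0.
apply: cb; last first.
  move=> t tz; rewrite Normc.normcM modulusX ler_pM ?exprn_ge0 ?modulus_ge0//.
    by apply: piL; case/andP: tz.
  by rewrite lerXn2r ?nnegrE ?modulus_ge0//; exact: GM.
move=> t; have [tA|tA] := boolP (t \in A); last first.
  by apply: derivable_mul; [exact: derivable_prod_subr|apply: derivable_exp; exact: dG].
have -> : (fun s => pi s * G s ^+ n) =
    fun s => (s - t) * (prod_subr (rem t A) s * G s ^+ n).
  by apply/funext => s; rewrite mulrA; congr (_ * _); exact: big_rem.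
apply: derivable_subr_mul; apply: continuous_mul; last exact: continuous_exp.
by apply: derivable_continuous; exact: derivable_prod_subr.
Qed.

(** At an exceptional point, by continuity from nearby centres; the wider shell
    leaves room for moving the centre. *)
Lemma max_modulus G (A : seq C) z (r M : R) : 0 < r ->
  (forall t, {for t, continuous G}) -> (forall t, t \notin A -> derivable G t 1) ->
  (forall t, r / 4 <= modulus (t - z) <= 2 * r -> modulus (G t) <= M) ->
  modulus (G z) <= M.
Proof.
move=> r0 cG dG GM; apply/ler_addgt0Pr => e e0.
have [d d0 Hd] := (continuous_modulusP G z).1 (cG z) _ e0.
have [m m0 Hm] := avoid_seq A z.
pose s := Num.min (Num.min d m) (r / 4) / 2.
have s0 : 0 < s by rewrite divr_gt0// !lt_min d0 m0 divr_gt0.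
have sle : s < Num.min (Num.min d m) (r / 4).
  by rewrite ltr_pdivrMr// ltr_pMr ?ltr1n// !lt_min d0 m0 divr_gt0.
move: sle; rewrite !lt_min => /andP[/andP[sd sm] sr].
have ms : modulus (s%:C%C : C) = s by rewrite modulus_nneg ?ltW.
have s1 := real_neq0 s0.
have zsA : z + s%:C%C \notin A by apply: Hm; rewrite ?ms.
have : modulus (G (z + s%:C%C)) <= M.
  apply: (max_modulus_off r0 cG dG zsA) => t /andP[t1 t2]; apply: GM.
  have h1 := modulus_triangle t (z + s%:C%C) z.
  have h2 := modulus_triangle t z (z + s%:C%C).
  have e1 : modulus (z + s%:C%C - z) = s by rewrite addrC addKr.
  have e2 : modulus (z - (z + s%:C%C)) = s by rewrite modulus_distC.
  rewrite e1 in h1; rewrite e2 in h2; apply/andP; split; lra.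
have : modulus (G (z + s%:C%C) - G z) <= e by apply: Hd; rewrite ms.
have := modulusB_ge (G z) (G (z + s%:C%C)); rewrite modulus_distC; lra.
Qed.

End RemovableSingularities.

(** * Divided differences of entire functions *)

Section DividedDifference.
Variable R : realType.
Local Notation C := (Cplx R).
Implicit Types (F q : C -> C) (a z t u : C).

Lemma bounded_on_disc (g : C -> R) (z : C) (r : R) : continuous g ->
  exists B, forall t, modulus (t - z) <= r -> `|g t| <= B.
Proof.
move=> cg; have [r0|r0] := ltP r 0.
  by exists 0 => t tr; have := le_trans (modulus_ge0 _) tr; lra.
pose phi (x : R * R) : C := (x.1 +i* x.2)%C.
pose K := `[complex.Re z - r, complex.Re z + r]%classic `*`
          `[complex.Im z - r, complex.Im z + r]%classic.
have cphi : continuous phi.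
  move=> x; apply/(@cvgrPdist_le _ C _ (nbhs x)) => e e0.
  have eE := gt0_real e0; rewrite eE ltcR in e0 *.
  have e2 : 0 < complex.Re e / 2 by rewrite divr_gt0.
  exists (ball x.1 (complex.Re e / 2), ball x.2 (complex.Re e / 2)).
    by split; exact: nbhsx_ballx.
  move=> y [/= y1 y2]; rewrite modulusE lecR; apply: le_trans (modulus_le_Re_Im _) _.
  by rewrite [leRHS]splitr !raddfB lerD//= ltW.
have cK : compact K by apply: compact_setX; exact: segment_compact.
have cgphi : continuous (fun x => `|g (phi x)|).
  move=> x; apply: continuous_comp; last exact: norm_continuous.
  by apply: continuous_comp; [exact: cphi|exact: cg].
have K0 : K !=set0.
  by exists (complex.Re z, complex.Im z); split; rewrite /= in_itv /= gerBl lerDl r0.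
have [c _ Hc] := compact_EVT_max K0 cK (continuous_subspaceT cgphi).
exists (`|g (phi c)|) => t tz.
have tE : phi (complex.Re t, complex.Im t) = t by case: (t).
rewrite -tE; apply: Hc; rewrite inE; split; rewrite /= in_itv /= -ler_distl.
  by rewrite -raddfB; apply: le_trans tz; exact: normr_Re_le_modulus.
by rewrite -raddfB; apply: le_trans tz; exact: normr_Im_le_modulus.
Qed.

Lemma modulus_continuous F : continuous F -> continuous (fun t => modulus (F t)).
Proof.
move=> cF z; apply/(@cvgrPdist_le _ _ _ (nbhs z)) => e e0.
have [d d0 Hd] := (continuous_modulusP F z).1 (cF z) _ e0.
apply/near_modulus; exists d => // h /Hd hd; rewrite ler_distl.
have := modulusB_ge (F z) (F (z + h)); have := modulusB_ge (F (z + h)) (F z).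
by move: hd; rewrite [modulus (F z - _)]modulus_distC; lra.
Qed.

Definition dquot F a t : C := if t == a then derive1 F a else (F t - F a) / (t - a).

Lemma dquotE F a t : t != a -> dquot F a t = (F t - F a) / (t - a).
Proof. by rewrite /dquot => /negPf ->. Qed.

Lemma dquot_diag F a : dquot F a a = derive1 F a.
Proof. by rewrite /dquot eqxx. Qed.

Lemma dquotK F a t : (t - a) * dquot F a t = F t - F a.
Proof.
have [->|ta] := eqVneq t a; first by rewrite !subrr mul0r.
by rewrite dquotE// mulrC divfK// subr_eq0.
Qed.

Lemma near_neq a t : t != a ->
  exists2 d : R, 0 < d & forall h, modulus h < d -> t + h != a.
Proof.
move=> ta; exists (modulus (t - a)) => [|h]; first by rewrite modulus_gt0// subr_eq0.
by apply: contraTneq => <-; rewrite opprD addNKr modulusN ltxx.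
Qed.

Lemma dquot_derivable F a t : t != a -> derivable F t 1 -> derivable (dquot F a) t 1.
Proof.
move=> ta dF; have [d d0 Hd] := near_neq ta.
have := derivable_div ta (derivable_sub dF (@derivable_cst _ _ _ (F a) _ _)).
move=> /derivable_has_derivP[l Hl]; apply/derivable_has_derivP; exists l.
by apply: has_deriv_congr d0 _ Hl => h hd; rewrite dquotE// Hd.
Qed.

Lemma dquot_continuous F a : continuous F -> derivable F a 1 -> continuous (dquot F a).
Proof.
move=> cF dF t; apply/continuous_modulusP => e e0.
have [->|ta] := eqVneq t a.
  have [d d0 Hd] := derivable_has_deriv dF e0.
  exists d => // h hd; rewrite dquot_diag.
  have [->|h0] := eqVneq h 0; first by rewrite addr0 dquot_diag subrr Normc.normc0 ltW.
  have ah : a + h != a by rewrite -subr_eq0 addrAC subrr add0r.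
  rewrite dquotE// addrAC subrr add0r.
  have -> : (F (a + h) - F a) / h - derive1 F a = (F (a + h) - F a - derive1 F a * h) / h.
    by rewrite [RHS]mulrBl mulfK.
  by rewrite modulus_div ler_pdivrMr ?modulus_gt0//; exact: Hd.
have [d d0 Hd] := near_neq ta.
have c1 : {for t, continuous (fun s : C => (F s - F a) / (s - a) : C)}.
  apply: (@continuous_mul R (fun s => F s - F a) (fun s => (s - a)^-1)).
    apply/continuous_modulusP => e' /((continuous_modulusP _ _).1 (cF t))[d' d'0 H].
    by exists d' => // h /H; rewrite opprB addrA subrK.
  have := @derivable_div R a (fun=> 1) t ta (@derivable_cst _ _ _ _ _ _).
  move=> /derivable_continuous; congr {for t, continuous _}.
  by apply/funext => s; exact: mul1r.
have [d' d'0 H] := (continuous_modulusP _ _).1 c1 _ e0.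
exists (Num.min d d'); first by rewrite lt_min d0.
move=> h; rewrite lt_min => /andP[hd hd']; rewrite !dquotE ?Hd//; exact: H.
Qed.

Lemma entire_continuous F : entire F -> continuous F.
Proof. by move=> eF z; exact: derivable_continuous. Qed.

(** Riemann's removable singularity for a divided difference [q]: the divided
    differences of [q] itself, as functions of their second node, satisfy the
    maximum principle, and so converge at [a] because they do away from [a]. *)
Theorem dquot_entire F a : entire F -> entire (dquot F a).
Proof.
move=> eF z; have [->|za] := eqVneq z a; last exact: dquot_derivable.
set q := dquot F a.
have cq : continuous q by apply: dquot_continuous; [exact: entire_continuous|exact: eF].
have dq u : u != a -> derivable q u 1 by move=> ua; exact: dquot_derivable.
have [B HB] := bounded_on_disc a 2 (modulus_continuous cq).
have {}HB t : modulus (t - a) <= 2 -> modulus (q t) <= B.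
  by move=> /HB; exact: le_trans (ler_norm _).
have B0 : 0 <= B by apply: le_trans (HB a _); rewrite ?modulus_ge0// subrr Normc.normc0.
have step u v : u != a -> v != a -> modulus (u - a) <= 8^-1 -> modulus (v - a) <= 8^-1 ->
    modulus (dquot q u a - dquot q v a) <=
      64 * (2 * B * modulus (u - v) + 3 * modulus (q v - q u)).
  move=> ua va u8 v8.
  have cont w t : w != a -> {for t, continuous (dquot q w)}.
    by move=> wa; apply: dquot_continuous => //; exact: dq.
  pose G t : C := dquot q u t - dquot q v t.
  apply: (@max_modulus R G [:: a; u; v] a 1 _ ltr01) => [t|t|t].
  - have := @continuousB _ C C _ _ t (cont u t ua) (cont v t va).
    by congr {for t, continuous _}; apply/funext.
  - rewrite !inE !negb_or => /and3P[ta tu tv].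
    by apply: derivable_sub; apply: dquot_derivable => //; exact: dq.
  - move=> /andP[t1 t2].
    have tu8 : 8^-1 <= modulus (t - u).
      by have := modulus_triangle t u a; lra.
    have tv8 : 8^-1 <= modulus (t - v).
      by have := modulus_triangle t v a; lra.
    have tu0 : t - u != 0 by apply: contraTneq tu8 => ->; rewrite Normc.normc0 -ltNge.
    have tv0 : t - v != 0 by apply: contraTneq tv8 => ->; rewrite Normc.normc0 -ltNge.
    have tu : t != u by rewrite -subr_eq0.
    have tv : t != v by rewrite -subr_eq0.
    rewrite /G (dquotE _ tu) (dquotE _ tv).
    have -> : (q t - q u) / (t - u) - (q t - q v) / (t - v) =
        ((q t - q v) * (u - v) + (q v - q u) * (t - v)) / ((t - u) * (t - v)).
      by field; rewrite tu0 tv0.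
    rewrite modulus_div Normc.normcM ler_pdivrMr; last by rewrite mulr_gt0 ?modulus_gt0.
    have tv3 : modulus (t - v) <= 3.
      by have := modulus_triangle t a v; rewrite [modulus (a - v)]modulus_distC; lra.
    have qt : modulus (q t - q v) <= 2 * B.
      apply: le_trans (modulusB_le _ _) _.
      have : modulus (q t) <= B by apply: HB; lra.
      have : modulus (q v) <= B by apply: HB; lra.
      lra.
    set X := 2 * B * _ + _.
    have X0 : 0 <= X by rewrite addr_ge0 ?mulr_ge0 ?modulus_ge0.
    apply: le_trans (_ : X <= _).
      apply: le_trans (modulusD_le _ _) _; rewrite !Normc.normcM lerD//.
        by rewrite ler_wpM2r ?modulus_ge0.
      by rewrite mulrC ler_wpM2r ?modulus_ge0.
    have : 64^-1 <= modulus (t - u) * modulus (t - v).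
      have -> : 64^-1 = 8^-1 * 8^-1 :> R by field.
      by rewrite ler_pM.
    nra.
have small e : 0 < e -> exists2 d : R, 0 < d & forall u v, u != a -> v != a ->
    modulus (u - a) < d -> modulus (v - a) < d ->
    modulus (dquot q u a - dquot q v a) <= e.
  move=> e0; have e1 : 0 < e / 1000 by lra.
  have [d d0 Hd] := (continuous_modulusP _ _).1 (cq a) _ e1.
  have B1 : 0 < B + 1 by rewrite ltr_wpDl.
  exists (Num.min d (Num.min 8^-1 (e / 1000 / (B + 1)))).
    by rewrite !lt_min d0 invr_gt0 ltr0n (divr_gt0 e1 B1).
  move=> u v ua va; rewrite !lt_min => /and3P[ud u8 ue] /and3P[vd v8 ve].
  apply: le_trans (step u v ua va (ltW u8) (ltW v8)) _.
  have qu := Hd _ ud; have qv := Hd _ vd; rewrite [a + _]addrC subrK in qu.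
  rewrite [a + _]addrC subrK in qv.
  have quv : modulus (q v - q u) <= e / 500.
    apply: le_trans (modulus_triangle _ (q a) _) _.
    by rewrite [modulus (q a - _)]modulus_distC; lra.
  have uv : B * modulus (u - v) <= e / 500.
    rewrite ltr_pdivlMr// in ue; rewrite ltr_pdivlMr// in ve.
    have := modulus_triangle u a v; rewrite [modulus (a - v)]modulus_distC.
    have := modulus_ge0 (u - a); have := modulus_ge0 (v - a).
    have := modulus_ge0 (u - v); nra.
  lra.
have [l Hl] : exists l : C, forall e : R, 0 < e ->
    \forall u \near a^', modulus (l - dquot q u a) <= e.
  apply: cauchy_limit => e /small[d d0 Hd].
  have d2 : 0 < d / 2 by rewrite divr_gt0.
  have dm : modulus ((d / 2)%:C%C : C) = d / 2 by rewrite modulus_nneg ?ltW.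
  have dn0 := real_neq0 d2.
  exists (dquot q (a + (d / 2)%:C%C) a); apply/dnear_modulus; exists d => // h hd h0.
  apply: Hd; rewrite ?addrK//.
  - by rewrite -subr_eq0 addrAC subrr add0r.
  - by rewrite -subr_eq0 addrAC subrr add0r.
  - by rewrite addrAC subrr add0r dm; lra.
  - by rewrite addrAC subrr add0r.
apply/derivable_has_derivP; exists l => e /Hl /dnear_modulus[d d0 Hd]; exists d => // h hd.
have [->|h0] := eqVneq h 0; first by rewrite addr0 mulr0 subr0 subrr Normc.normc0 mulr0.
have ah : a != a + h by rewrite eq_sym -subr_eq0 addrAC subrr add0r.
have -> : q (a + h) - q a - l * h = - ((l - dquot q (a + h) a) * h).
  have -> : q (a + h) - q a = h * dquot q (a + h) a.
    by rewrite -opprB -(dquotK q (a + h) a); ring.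
  by ring.
by rewrite modulusN Normc.normcM ler_wpM2r ?modulus_ge0//; exact: Hd.
Qed.

End DividedDifference.

(** * Growth estimates for the operators *)

Section Operators.
Variables (R : realType) (w : weights R).
Local Notation C := (Cplx R).
Local Notation E := (LFspace w).

Definition dominated (v : C -> R) (A : R) (f : C -> C) :=
  forall z, modulus (f z) <= A * expR (v z).

Lemma weighted_norm_leP v A f : (weighted_norm v f <= A%:E)%E <-> dominated v A f.
Proof.
split=> [H z|H].
  rewrite -ler_pdivrMr ?expR_gt0// -lee_fin; apply: le_trans H.
  by apply: ereal_sup_ubound; exists z.
by apply: ge_ereal_sup => _ [z _ <-]; rewrite lee_fin ler_pdivrMr ?expR_gt0.
Qed.

Lemma step_dominated n k (f : C -> C) : step w n f ->
  exists2 A, 0 <= A & dominated (w n k) A f.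
Proof.
move=> [_ /(_ k) H]; have f0 := weighted_norm_ge0 (w n k) f.
exists (fine (weighted_norm (w n k) f)); first exact: fine_ge0.
by apply/weighted_norm_leP; rewrite fineK// ge0_fin_numE.
Qed.

Lemma dominated_step n (f : C -> C) : entire f ->
  (forall k, exists A, dominated (w n k) A f) -> step w n f.
Proof.
move=> ef H; split=> // k; have [A /weighted_norm_leP HA] := H k.
exact: le_lt_trans HA (ltry _).
Qed.

Lemma wt_le_decr n k j z : (j <= k)%N -> w n k z <= w n j z.
Proof.
move=> /subnKC <-; elim: (k - j)%N => [|i IH]; first by rewrite addn0.
by rewrite addnS; apply: le_trans (wt_decr _ _ _ _) IH.
Qed.

Lemma wt_le_incr n m k z : (n <= m)%N -> w n k z <= w m k z.
Proof.
move=> /subnKC <-; elim: (m - n)%N => [|i IH]; first by rewrite addn0.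
by rewrite addnS; apply: le_trans IH (wt_incr _ _ _ _).
Qed.

Lemma dominated_le (v v' : C -> R) A f : 0 <= A -> (forall z, v z <= v' z) ->
  dominated v A f -> dominated v' A f.
Proof.
move=> A0 vv H z; apply: le_trans (H z) _.
by rewrite ler_wpM2l// ler_expR.
Qed.

(** Two target weights at once, because [Ttilde_fun g z h t] is estimated in [t]
    and in [z] by different weights. *)
Lemma growth n : exists m, forall k k', exists s K, 0 <= K /\
  forall (z t t' : C), modulus (t - z) <= 1 -> modulus (t' - z) <= 1 ->
    (1 + modulus z) * expR (w n s t) <= K * expR (w m k t') /\
    (1 + modulus z) * expR (w n s t) <= K * expR (w m k' t').
Proof.
have [m Hm] := wt_growth w n; exists m => k k'.
have H1 k1 : exists s K, 0 <= K /\ forall s', (s <= s')%N -> forall (z t t' : C),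
    modulus (t - z) <= 1 -> modulus (t' - z) <= 1 ->
    (1 + modulus z) * expR (w n s' t) <= K * expR (w m k1 t').
  have [s [c c0 Hs]] := Hm k1; exists s, (expR c).
  split=> [|s' ss' z t t' tz t'z]; first exact: expR_ge0.
  have z1 : 0 < 1 + modulus z by rewrite ltr_wpDr ?modulus_ge0.
  rewrite -[1 + modulus z]lnK ?posrE// -!expRD ler_expR addrC.
  apply: le_trans (_ : sup [set w n s t | t in unit_disc z] + ln (1 + modulus z) <= _).
    rewrite lerD2r; apply: le_trans (wt_le_decr _ _ ss') _.
    apply: ub_le_sup; last by exists t.
    have [B HB] := bounded_on_disc z 1 (@wt_continuous _ w n s).
    by exists B => _ [u uz <-]; apply: le_trans (ler_norm _) (HB _ uz).
  apply: le_trans (Hs z) _; rewrite addrC lerD2l.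
  apply: ge_inf; last by exists t'.
  have [B HB] := bounded_on_disc z 1 (@wt_continuous _ w m k1).
  by exists (- B) => _ [u uz <-]; have := HB _ uz; rewrite ler_norml => /andP[].
have [s1 [K1 [K10 h1]]] := H1 k; have [s2 [K2 [K20 h2]]] := H1 k'.
exists (maxn s1 s2), (K1 + K2); split=> [|z t t' tz t'z]; first exact: addr_ge0.
have := h1 _ (leq_maxl s1 s2) z t t' tz t'z.
have := h2 _ (leq_maxr s1 s2) z t t' tz t'z.
have := mulr_ge0 K20 (expR_ge0 (w m k t')).
have := mulr_ge0 K10 (expR_ge0 (w m k' t')).
by rewrite !(mulrDl K1 K2) => p1 p2 p3 p4; split; lra.
Qed.

Lemma LF_entire (h : E) : entire h.
Proof. by have [n []] := LF_step h. Qed.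

Lemma to_LFK n (h : C -> C) : step w n h -> to_LF w h = h :> (C -> C).
Proof.
move=> sh; rewrite /to_LF insubdK// /steps_union inE; by exists n.
Qed.

Lemma LF_eqP (x y : E) : (forall z, x z = y z) -> x = y.
Proof. by move=> xy; apply: val_inj; apply/funext. Qed.

Definition mulX_fun (h : C -> C) (t : C) : C := t * h t.

Definition mulX (h : E) : E := to_LF w (mulX_fun h).

Lemma mulX_fun_entire h : entire h -> entire (mulX_fun h).
Proof. by move=> eh z; apply: derivable_mul (eh z); exact: derivable_id. Qed.

Lemma mulX_bound n : exists m, forall k, exists s K, 0 <= K /\
  forall A h, 0 <= A -> dominated (w n s) A h -> dominated (w m k) (K * A) (mulX_fun h).
Proof.
have [m Hm] := growth n; exists m => k; have [s [K [K0 H]]] := Hm k k.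
exists s, K; split=> // A h A0 hA z; rewrite Normc.normcM.
have zz : modulus (z - z) <= 1 by rewrite subrr Normc.normc0.
have [H1 _] := H z z z zz zz.
apply: le_trans (_ : modulus z * (A * expR (w n s z)) <= _).
  by rewrite ler_wpM2l ?modulus_ge0.
rewrite mulrCA [K * A]mulrC -mulrA ler_wpM2l//; apply: le_trans H1.
by rewrite ler_wpM2r ?expR_ge0// lerDr.
Qed.

Lemma mulX_step n : exists m, forall h, step w n h -> step w m (mulX_fun h).
Proof.
have [m Hm] := mulX_bound n; exists m => h sh; apply: dominated_step.
  by apply: mulX_fun_entire; case: sh.
move=> k; have [s [K [_ H]]] := Hm k; have [A A0 hA] := step_dominated s sh.
by exists (K * A); exact: H.
Qed.

Lemma mulXE (h : E) z : mulX h z = z * h z.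
Proof.
have [n sh] := LF_step h; have [m Hm] := mulX_step n.
by rewrite /mulX (to_LFK (Hm _ sh)).
Qed.

Lemma Ttilde_funE (g h : C -> C) z t :
  Ttilde_fun g z h t = dquot h z t * g z - h z * dquot g z t.
Proof.
rewrite /Ttilde_fun /dquot; case: ifP => // /negbT tz.
by field; rewrite subr_eq0.
Qed.

Lemma Ttilde_fun_sym (g h : C -> C) z t : Ttilde_fun g z h t = Ttilde_fun g t h z.
Proof.
rewrite /Ttilde_fun eq_sym; case: eqVneq => [->//|tz].
by field; rewrite !subr_eq0 tz eq_sym.
Qed.

Lemma Ttilde_fun_entire (g h : C -> C) z : entire g -> entire h ->
  entire (Ttilde_fun g z h).
Proof.
move=> eg eh t.
have -> : Ttilde_fun g z h = fun t => dquot h z t * g z - h z * dquot g z t.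
  by apply/funext => s; exact: Ttilde_funE.
apply: (@derivable_sub R (fun t => dquot h z t * g z) (fun t => h z * dquot g z t)).
  apply: (@derivable_mul R (dquot h z) (fun=> g z)); last exact: derivable_cst.
  exact: dquot_entire.
apply: (@derivable_mul R (fun=> h z) (dquot g z)); first exact: derivable_cst.
exact: dquot_entire.
Qed.

(** The numerator satisfies the estimate by the growth condition, and so does the
    quotient as long as [t] is not near [z]. Otherwise the maximum principle moves
    [t] away from [z], to points of the same unit disc, over which the growth
    condition compares the weights. *)
Lemma Ttilde_fun_bound (g : E) n : exists m, forall k k', exists s K, 0 <= K /\
  forall A h, 0 <= A -> entire h -> dominated (w n s) A h -> forall z t,
    modulus (Ttilde_fun g z h t) <= K * A * expR (w m k t) * expR (w m k' z).
Proof.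
have [ng gn] := LF_step g; pose N := maxn n ng.
have [m Hm] := growth N; exists m => k k'; have [s [K [K0 H]]] := Hm k k'.
have [B B0 gB] := step_dominated s (step_incr (leq_maxr n ng) gn).
exists s, (16 * B * K ^+ 2); split=> [|A h A0 eh hA z t].
  by rewrite !mulr_ge0 ?exprn_ge0.
have {}hA : dominated (w N s) A h.
  by apply: dominated_le hA => // u; apply: wt_le_incr; exact: leq_maxl.
have H' (z0 u u' : C) : modulus (u - z0) <= 1 -> modulus (u' - z0) <= 1 ->
    expR (w N s u) <= K * expR (w m k u') /\ expR (w N s u) <= K * expR (w m k' u').
  move=> h1 h2; have [H1 H2] := H _ _ _ h1 h2.
  have : expR (w N s u) <= (1 + modulus z0) * expR (w N s u).
    by rewrite ler_peMl ?expR_ge0// lerDl modulus_ge0.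
  by move=> h3; split; apply: le_trans h3 _.
set X := _ * expR (w m k' z).
have zz (x : C) : modulus (x - x) <= 1 by rewrite subrr Normc.normc0.
have far (z0 t' : C) : modulus (t - z0) <= 1 -> modulus (t' - z0) <= 1 ->
    8^-1 <= modulus (t' - z) -> modulus (Ttilde_fun g z h t') <= X.
  move=> tz0 t'z0 t'z.
  have t'z0' : t' - z != 0 by apply: contraTneq t'z => ->; rewrite Normc.normc0 -ltNge.
  rewrite /Ttilde_fun -subr_eq0 (negPf t'z0') modulus_div ler_pdivrMr ?modulus_gt0//.
  apply: le_trans (modulusB_le _ _) _; rewrite !Normc.normcM.
  have [h1 _] := H' _ _ _ t'z0 tz0; have [_ h2] := H' _ _ _ (zz z) (zz z).
  have b1 : modulus (h t') <= A * (K * expR (w m k t)).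
    by apply: le_trans (hA t') _; rewrite ler_wpM2l.
  have b2 : modulus (g t') <= B * (K * expR (w m k t)).
    by apply: le_trans (gB t') _; rewrite ler_wpM2l.
  have b3 : modulus (h z) <= A * (K * expR (w m k' z)).
    by apply: le_trans (hA z) _; rewrite ler_wpM2l.
  have b4 : modulus (g z) <= B * (K * expR (w m k' z)).
    by apply: le_trans (gB z) _; rewrite ler_wpM2l.
  pose Y := A * (K * expR (w m k t)) * (B * (K * expR (w m k' z))).
  have -> : X = 16 * Y by rewrite /X /Y; ring.
  have y1 : modulus (h t') * modulus (g z) <= Y by rewrite ler_pM ?modulus_ge0.
  have y2 : modulus (h z) * modulus (g t') <= Y.
    have -> : Y = A * (K * expR (w m k' z)) * (B * (K * expR (w m k t))).
      by rewrite /Y; ring.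
    by rewrite ler_pM ?modulus_ge0.
  have Y0 : 0 <= Y by apply: le_trans y1; rewrite mulr_ge0 ?modulus_ge0.
  nra.
have [tz|tz] := leP 8^-1 (modulus (t - z)); first exact: (far t t).
have r0 : 0 < 2^-1 :> R by rewrite invr_gt0.
have eT := @Ttilde_fun_entire g h z (@LF_entire g) eh.
have mm := @max_modulus_off R (Ttilde_fun g z h) [::] t 2^-1 X r0.
apply: mm; [exact: entire_continuous|by move=> u _; exact: eT|by []|move=> t' /andP[t1 t2]].
have := modulus_triangle t' t z; have := modulus_triangle t' z t => h1 h2.
have zt := modulus_distC z t.
by apply: (far z); lra.
Qed.

Lemma Ttilde_bound (g : E) n : exists m,
  (forall z h, step w n h -> step w m (Ttilde_fun g z h)) /\
  forall k k', exists s K, 0 <= K /\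
    forall A h, 0 <= A -> entire h -> dominated (w n s) A h -> forall z t,
      modulus (Ttilde_fun g z h t) <= K * A * expR (w m k t) * expR (w m k' z).
Proof.
have [m Hm] := Ttilde_fun_bound g n; exists m; split=> // z h sh.
have eh : entire h by case: sh.
apply: dominated_step; first exact: Ttilde_fun_entire (@LF_entire g) eh.
move=> k; have [s [K [_ H]]] := Hm k 0%N; have [A A0 hA] := step_dominated s sh.
exists (K * A * expR (w m 0%N z)) => t.
by rewrite mulrAC; exact: H.
Qed.

Lemma Ttilde_opE (g h : E) z t : Ttilde_op g z h t = Ttilde_fun g z h t.
Proof.
have [n sh] := LF_step h; have [m [mT _]] := Ttilde_bound g n.
by rewrite /Ttilde_op (to_LFK (mT z _ sh)).
Qed.

Lemma pommiezE (g h : E) : g 0 = 1 -> pommiez g h = Ttilde_op g 0 h.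
Proof.
move=> g0; rewrite /pommiez /Ttilde_op; congr (to_LF w _).
have swap (x y u v : C) : v = 1 -> x - y * u = x * v - u * y.
  by move=> ->; rewrite mulr1 mulrC.
apply/funext => t; rewrite /pommiez_fun /Ttilde_fun; case: ifP => _.
  exact: (swap (derive1 h 0) (derive1 g 0) (h 0) (g 0) g0).
rewrite (subr0 t); congr (_ / t).
exact: (swap (h t) (g t) (h 0) (g 0) g0).
Qed.

(** The divided difference of [t * h t] at [z] is [h t + z * dquot h z t], which
    is continuous in [t]. *)
Lemma derive1_mulX_fun h z : entire h ->
  derive1 (mulX_fun h) z = h z + z * derive1 h z.
Proof.
move=> eh; apply: has_deriv_derive1.
pose q t : C := h t + z * dquot h z t.
have cq : {for z, continuous q}.
  apply: derivable_continuous.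
  apply: (@derivable_add R h (fun t => z * dquot h z t)); first exact: eh.
  apply: (@derivable_mul R (fun=> z) (dquot h z)); first exact: derivable_cst.
  exact: dquot_entire.
move=> e /((continuous_modulusP _ _).1 cq)[d d0 Hd]; exists d => // k /Hd.
have -> : mulX_fun h (z + k) - mulX_fun h z - (h z + z * derive1 h z) * k =
    (q (z + k) - q z) * k.
  have := dquotK h z (z + k); rewrite addrAC subrr add0r /q dquot_diag /mulX_fun => E.
  transitivity (z * (h (z + k) - h z) + h (z + k) * k - (h z + z * derive1 h z) * k).
    by ring.
  by rewrite -E; ring.
by move=> Hk; rewrite Normc.normcM ler_wpM2r ?modulus_ge0.
Qed.

Lemma derive1_mulX (h : E) z : derive1 (mulX h) z = h z + z * derive1 h z.
Proof.
have [n sh] := LF_step h; have [m Hm] := mulX_step n.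
by rewrite /mulX (to_LFK (Hm _ sh)) derive1_mulX_fun//; exact: LF_entire.
Qed.

Lemma T_opE (g h : E) z : T_op g z h = Ttilde_op g z (mulX h).
Proof.
have [n sh] := LF_step h; have [m Hm] := mulX_step n.
rewrite /T_op /Ttilde_op; congr (to_LF w _); apply/funext => t.
rewrite /T_fun /Ttilde_fun (to_LFK (Hm _ sh)).
case: ifP => _; last by [].
have aux (v u d d' k : C) : k = u + z * d ->
    z * v * d - z * u * d' + u * v = k * v - z * u * d' by move=> ->; ring.
exact: (aux (g z) (h z) (derive1 h z) (derive1 g z) _ (derive1_mulX_fun z (@LF_entire h))).
Qed.

Lemma has_deriv_lin (a l m : C) (f g : C -> C) z : has_deriv f z l ->
  has_deriv g z m -> has_deriv (fun t => a * f t + g t) z (a * l + m).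
Proof.
move=> Hf Hg e e0; have e2 : 0 < e / 2 by rewrite divr_gt0.
have a1 : 0 < modulus a + 1 by rewrite ltr_wpDl ?modulus_ge0.
have [d d0 {}Hf] := Hf _ (divr_gt0 e2 a1); have [d' d'0 {}Hg] := Hg _ e2.
exists (Num.min d d'); first by rewrite lt_min d0.
move=> h; rewrite lt_min => /andP[/Hf{}Hf /Hg{}Hg].
have -> : a * f (z + h) + g (z + h) - (a * f z + g z) - (a * l + m) * h =
    a * (f (z + h) - f z - l * h) + (g (z + h) - g z - m * h) by ring.
apply: le_trans (modulusD_le _ _) _; rewrite [e in leRHS]splitr mulrDl lerD//.
rewrite Normc.normcM; apply: le_trans (ler_wpM2l (modulus_ge0 a) Hf) _.
rewrite mulrA ler_wpM2r ?modulus_ge0// mulrCA ger_pMr// ler_pdivrMr// mul1r.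
by rewrite lerDl.
Qed.

Lemma LF_lin_derive1 (a : R[i]) (x y : E) z :
  derive1 (a *: x + y : E) z = a * derive1 x z + derive1 y z.
Proof.
have hx := derivable_has_deriv (@LF_entire x z).
have hy := derivable_has_deriv (@LF_entire y z).
exact: (has_deriv_derive1 (has_deriv_lin a hx hy)).
Qed.

Lemma Ttilde_op_linear (g : E) z (a : R[i]) (x y : E) :
  Ttilde_op g z (a *: x + y) = a *: Ttilde_op g z x + Ttilde_op g z y.
Proof.
apply: LF_eqP => t; rewrite Ttilde_opE.
rewrite [RHS]/(a * Ttilde_op g z x t + Ttilde_op g z y t : C) !Ttilde_opE.
have aux1 (k d d' u v g1 g2 : C) : k = a * d + d' ->
    k * g1 - (a * u + v) * g2 = a * (d * g1 - u * g2) + (d' * g1 - v * g2).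
  by move=> ->; ring.
rewrite /Ttilde_fun; case: ifP => [_|/negbT tz].
  exact: (aux1 _ _ _ (x z) (y z) _ _ (LF_lin_derive1 a x y z)).
have aux2 (u v u' v' g1 g2 s : C) : ((a * u + v) * g1 - (a * u' + v') * g2) / s =
    a * ((u * g1 - u' * g2) / s) + (v * g1 - v' * g2) / s.
  by ring.
exact: (aux2 (x t) (y t) (x z) (y z) (g z) (g t)).
Qed.

Lemma mulX_linear (a : R[i]) (x y : E) : mulX (a *: x + y) = a *: mulX x + mulX y.
Proof.
apply: LF_eqP => t.
rewrite [RHS]/(a * mulX x t + mulX y t : C) !mulXE.
have aux (u v : C) : t * (a * u + v) = a * (t * u) + t * v by ring.
exact: (aux (x t) (y t)).
Qed.

Lemma Ttilde_op_self (g : E) z : Ttilde_op g z g = 0.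
Proof.
apply: LF_eqP => t; rewrite Ttilde_opE [RHS]/(0 : C).
have aux (u v : C) : u * v - v * u = 0 by ring.
rewrite /Ttilde_fun; case: ifP => _; first exact: aux.
by rewrite (aux (g t) (g z)) mul0r.
Qed.

Lemma T_op_Ttilde (g h : E) z : T_op g z h = g z *: h + z *: Ttilde_op g z h.
Proof.
rewrite T_opE; apply: LF_eqP => t.
rewrite [RHS]/(g z * h t + z * Ttilde_op g z h t : C) !Ttilde_opE.
rewrite /Ttilde_fun; case: eqVneq => [->|tz].
  have aux (k u d g1 g2 v : C) : k = u + z * d -> v = z * u ->
    k * g1 - v * g2 = g1 * u + z * (d * g1 - u * g2) by move=> -> ->; ring.
  exact: (aux _ _ _ _ _ _ (derive1_mulX h z) (mulXE h z)).
have aux (u v v' u' g1 g2 : C) : v = t * u -> v' = z * u' ->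
    (v * g1 - v' * g2) / (t - z) = g1 * u + z * ((u * g1 - u' * g2) / (t - z)).
  by move=> -> ->; field; rewrite subr_eq0.
exact: (aux _ _ _ _ _ _ (mulXE h t) (mulXE h z)).
Qed.

Lemma mulX_pommiez (g h : E) : g 0 = 1 -> mulX (pommiez g h) = - (h 0) *: g + h.
Proof.
move=> g0; rewrite (pommiezE h g0); apply: LF_eqP => t; rewrite mulXE Ttilde_opE.
rewrite [RHS]/(- h 0 * g t + h t : C) /Ttilde_fun; case: eqVneq => [->|t0].
  have aux0 (u v d : C) : v = 1 -> 0 * d = - u * v + u by move=> ->; ring.
  exact: (aux0 (h 0) (g 0) _ g0).
have aux (u v g1 g2 : C) : g2 = 1 -> t * ((u * g2 - v * g1) / (t - 0)) = - v * g1 + u.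
  by move=> ->; rewrite subr0; field.
exact: (aux (h t) (h 0) (g t) (g 0) g0).
Qed.

Lemma mulX_inj : injective mulX.
Proof.
move=> x y xy; apply: LF_eqP.
have off z : z != 0 -> x z = y z.
  move=> z0; have := congr1 (fun h : E => h z) xy; rewrite /= !mulXE.
  by move/(mulfI z0).
move=> z; have [->|/off//] := eqVneq z 0.
apply/eqP; rewrite -subr_eq0; apply/eqP; apply: modulus_le0.
apply/ler_addgt0Pr => e e0; have e2 : 0 < e / 2 by rewrite divr_gt0.
have [d d0 Hd] := (continuous_modulusP x 0).1 (derivable_continuous (@LF_entire x 0)) _ e2.
have [d' d'0 Hd'] := (continuous_modulusP y 0).1 (derivable_continuous (@LF_entire y 0)) _ e2.
pose s := Num.min d d' / 2; have s0 : 0 < s by rewrite divr_gt0// lt_min d0.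
have sm : s < Num.min d d' by rewrite ltr_pdivrMr// ltr_pMr ?ltr1n// lt_min d0.
have ms : modulus (s%:C%C : C) = s by rewrite modulus_nneg ?ltW.
have sn0 := real_neq0 s0.
move: sm; rewrite lt_min => /andP[sd sd'].
have h1 := Hd s%:C%C; have h2 := Hd' s%:C%C; rewrite ms add0r in h1 h2.
have := h2 sd'; have := h1 sd; rewrite (off _ sn0) => {}h1 {}h2.
rewrite add0r; apply: le_trans (modulus_triangle _ (y s%:C%C) _) _.
by rewrite [modulus (x 0 - _)]modulus_distC [e]splitr lerD.
Qed.

Lemma pommiez_mulX (g h : E) : g 0 = 1 -> pommiez g (mulX h) = h.
Proof.
move=> g0; apply: mulX_inj; by rewrite mulX_pommiez// mulXE mul0r oppr0 scale0r add0r.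
Qed.

End Operators.

(** * Functionals and bounded operators *)

Section BoundedOperators.
Variables (R : realType) (w : weights R).
Local Notation C := (Cplx R).
Local Notation E := (LFspace w).

(** The continuous linear functionals, scaled to be at most 1 on a basic
    neighbourhood of 0. *)
Definition in_dual (phi : E -> R[i]) :=
  (forall a x y, phi (a *: x + y) = a * phi x + phi y) /\
  exists2 V, LF_base V & forall v, V v -> modulus (phi v) <= 1.

Section DualTheory.
Variable phi : E -> R[i].
Hypothesis dphi : in_dual phi.

Lemma dual0 : phi 0 = 0.
Proof.
have := dphi.1 0 0 0; rewrite scale0r addr0 mul0r add0r.
have := dphi.1 1 0 0; rewrite scale1r mul1r addr0 => /esym/eqP.
by rewrite -subr_eq0 addrK => /eqP.
Qed.

Lemma dualD x y : phi (x + y) = phi x + phi y.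
Proof. by have := dphi.1 1 x y; rewrite scale1r mul1r. Qed.

Lemma dualZ a x : phi (a *: x) = a * phi x.
Proof. by have := dphi.1 a x 0; rewrite !addr0 dual0 addr0. Qed.

Lemma dualB x y : phi (x - y) = phi x - phi y.
Proof. by rewrite -scaleN1r dualD dualZ mulN1r. Qed.

Lemma dual_sum n (c : 'I_n -> R[i]) (u : 'I_n -> E) :
  phi (\sum_(i < n) c i *: u i) = \sum_(i < n) c i * phi (u i).
Proof.
elim: n c u => [|n IH] c u; first by rewrite !big_ord0 dual0.
by rewrite !big_ord_recr /= dualD dualZ IH.
Qed.

Lemma dual_bound n : exists k K, 0 <= K /\ forall h A, step w n (LFfun h) -> 0 <= A ->
  dominated (w n k) A h -> modulus (phi h) <= K * A.
Proof.
have [_ [V [_ /(_ n)[k [e e0 He]]] phiV]] := dphi.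
exists k, (2 / e); split=> [|h A sh A0 hA]; first by rewrite divr_ge0 ?ltW.
have main A1 : 0 < A1 -> A <= A1 -> modulus (phi h) <= 2 / e * A1.
  move=> A10 AA1; pose c := e / (2 * A1).
  have c0 : 0 < c by rewrite divr_gt0 ?mulr_gt0.
  have Vh : V (c%:C%C *: h).
    apply: He => [|j jk]; first exact: stepZ.
    apply: (@le_lt_trans _ _ (e / 2)%:E); last first.
      by rewrite lte_fin ltr_pdivrMr// mulr_natr mulr2n ltrDl.
    apply/weighted_norm_leP => z.
    rewrite [(c%:C%C *: h) z]/(c%:C%C * h z) Normc.normcM (modulus_nneg (ltW c0)).
    have -> : e / 2 = c * A1 by rewrite /c; field; rewrite gt_eqF.
    rewrite -mulrA ler_pM2l//; apply: le_trans (hA z) _.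
    by rewrite ler_pM ?expR_ge0// ler_expR wt_le_decr.
  have := phiV _ Vh; rewrite dualZ Normc.normcM (modulus_nneg (ltW c0)) => H.
  have -> : 2 / e * A1 = c^-1 by rewrite /c; field; rewrite !gt_eqF.
  by rewrite -[c^-1]mul1r ler_pdivlMr// mulrC.
apply/ler_addgt0Pr => d d0.
have de : 0 < d * e / 2 by rewrite divr_gt0 ?mulr_gt0.
apply: le_trans (main (A + d * e / 2) _ _) _; first by rewrite ltr_wpDl.
  by rewrite lerDl ltW.
by rewrite mulrDr lerD2l le_eqVlt; apply/orP; left; apply/eqP; field; rewrite gt_eqF.
Qed.

End DualTheory.

(** Continuity from each step into some step, in terms of single weights. *)
Definition bounded_op (T : E -> E) := forall n, exists m, forall k, exists s K, 0 <= K /\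
  forall h A, step w n (LFfun h) -> 0 <= A -> dominated (w n s) A h ->
    step w m (LFfun (T h)) /\ dominated (w m k) (K * A) (T h).

Lemma bounded_op_comp S T : bounded_op S -> bounded_op T -> bounded_op (S \o T).
Proof.
move=> HS HT n; have [m Hm] := HT n; have [p Hp] := HS m; exists p => k.
have [s [K [K0 H]]] := Hp k; have [s' [K' [K'0 H']]] := Hm s.
exists s', (K * K'); split=> [|h A sh A0 hA]; first exact: mulr_ge0.
have [sT dT] := H' h A sh A0 hA.
by rewrite -mulrA; apply: H => //; exact: mulr_ge0.
Qed.

Lemma bounded_op_base T : (forall a x y, T (a *: x + y) = a *: T x + T y) ->
  bounded_op T -> forall V, LF_base V -> LF_base [set h | V (T h)].
Proof.
move=> lT bT V [aV sV]; split=> [a b x y ab Vx Vy|n].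
  have TZ c u : T (c *: u) = c *: T u.
    have T0 : T 0 = 0.
      have := lT 1 0 0; rewrite !scale1r addr0 => /esym/eqP.
      by rewrite -subr_eq0 addrK => /eqP.
    by have := lT c u 0; rewrite !addr0 T0 addr0.
  by rewrite /= lT TZ; exact: aV.
have [m Hm] := bT n; have [k [e e0 He]] := sV m; have [s [K [K0 H]]] := Hm k.
have K1 : 0 < K + 1 by rewrite ltr_wpDl.
exists s, (e / (K + 1)) => [|h sh nh]; first by rewrite divr_gt0.
have A0 : 0 <= e / (K + 1) by rewrite divr_ge0 ?ltW.
have [sT dT] := H h _ sh A0 ((weighted_norm_leP _ _ _).1 (ltW (nh s (leqnn s)))).
apply: He => // j jk; apply: le_lt_trans (weighted_norm_mono _ _) _.
  by move=> z; exact: wt_le_decr jk.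
apply: le_lt_trans ((weighted_norm_leP _ _ _).2 dT) _.
by rewrite lte_fin mulrCA gtr_pMr// ltr_pdivrMr// mul1r ltrDl.
Qed.

Lemma bounded_op_continuous (T : {linear E -> E}) : bounded_op T -> continuous T.
Proof.
move=> bT x A /LF_nbhsE[V bV VA]; apply/LF_nbhsE; exists [set h | V (T h)].
  by apply: bounded_op_base => // a y z; rewrite linearP.
by move=> y Vy; apply: VA; rewrite -linearB.
Qed.

Lemma mulX_bounded : bounded_op (@mulX R w).
Proof.
move=> n; have [m Hm] := mulX_bound w n; exists m => k.
have [s [K [K0 H]]] := Hm k; exists s, K; split=> // h A sh A0 hA.
have mE : LFfun (mulX h) = mulX_fun h by apply/funext => t; rewrite mulXE.
rewrite mE; split; last exact: H.
apply: dominated_step; first by apply: mulX_fun_entire; exact: LF_entire.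
move=> k'; have [s' [K' [_ H']]] := Hm k'; have [A' A'0 hA'] := step_dominated s' sh.
by exists (K' * A'); exact: H'.
Qed.

(** * The operator attached to a functional *)

Section Resolvent.
Variables (g : E) (phi : E -> R[i]).
Hypothesis dphi : in_dual phi.

(** The operator of the commutant that belongs to [phi] sends [h] to the function
    [z |-> phi (T_z h)]. As [T_z h] is [Ttilde_z] of [t * h t], it is multiplication
    by [t] followed by this transform, which in turn is its composition with the
    Pommiez operator. *)
Definition Ttilde_transform_fun (h : E) (z : C) : C := phi (Ttilde_op g z h).

(** Away from the node [b] the quotient is bounded by its definition, and near [b]
    by the maximum principle. *)
Lemma dquot_bound (f : C -> C) (z0 a b : C) (r M : R) : entire f ->
  (forall t, modulus (t - z0) <= r + 4^-1 -> modulus (f t) <= M) ->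
  modulus (a - z0) <= r -> modulus (b - z0) <= r -> modulus (dquot f b a) <= 32 * M.
Proof.
move=> ef fM ar br.
have M0 : 0 <= M by apply: le_trans (fM a _); [exact: modulus_ge0|lra].
have far t : modulus (t - z0) <= r + 4^-1 -> 16^-1 <= modulus (t - b) ->
    modulus (dquot f b t) <= 32 * M.
  move=> tr tb; have tb0 : 0 < modulus (t - b) by apply: lt_le_trans tb; rewrite invr_gt0.
  have tb1 : t != b by apply: contraTneq tb0 => ->; rewrite subrr Normc.normc0 ltxx.
  rewrite (dquotE _ tb1) modulus_div ler_pdivrMr//; apply: le_trans (modulusB_le _ _) _.
  have := fM t tr; have : modulus (f b) <= M by apply: fM; lra.
  nra.
have [ab|ab] := leP 16^-1 (modulus (a - b)); first by apply: far => //; lra.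
have r0 : 0 < 4^-1 :> R by rewrite invr_gt0.
have mm := @max_modulus_off R (dquot f b) [::] a 4^-1 (32 * M) r0.
have eq := @dquot_entire R f b ef.
apply: mm; [exact: entire_continuous|by move=> u _; exact: eq|by []|move=> t /andP[t1 t2]].
have := modulus_triangle t a z0; have := modulus_triangle t b a.
rewrite [modulus (b - a)]modulus_distC => h1 h2.
by apply: far; lra.
Qed.

(** A second-order Taylor estimate at [z0] in which the derivative does not
    appear: two applications of [dquot_bound], hence the constant. *)
Lemma dquot_lipschitz (f : C -> C) (z0 a b : C) (M : R) : entire f ->
  (forall t, modulus (t - z0) <= 1 -> modulus (f t) <= M) ->
  modulus (a - z0) <= 4^-1 -> modulus (b - z0) <= 4^-1 ->
  modulus (dquot f z0 a - dquot f z0 b) <= 32 * (32 * M) * modulus (a - b).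
Proof.
move=> ef fM ar br; have eq := @dquot_entire R f z0 ef.
have qM t : modulus (t - z0) <= 4^-1 + 4^-1 -> modulus (dquot f z0 t) <= 32 * M.
  move=> tz; apply: (@dquot_bound f z0 t z0 (4^-1 + 4^-1)) => //.
    by move=> u uz; apply: fM; lra.
  by rewrite subrr Normc.normc0; lra.
have := dquot_bound eq qM ar br; rewrite -(dquotK (dquot f z0) b a) Normc.normcM => H.
by rewrite mulrC ler_wpM2r ?modulus_ge0.
Qed.

(** [Ttilde_fun] is symmetric, hence entire in [z]. Its difference quotients in [z]
    are Lipschitz functions of the increment, in the norm of a step, by
    [dquot_lipschitz]; so their images under [phi] form a Cauchy family. *)
Lemma Ttilde_transform_entire h : entire (Ttilde_transform_fun h).
Proof.
move=> z0; have [n sh] := LF_step h; have [m [mT Hm]] := Ttilde_bound g n.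
have sT z : step w m (LFfun (Ttilde_op g z h)).
  have -> : LFfun (Ttilde_op g z h) = Ttilde_fun g z h.
    by apply/funext => t; exact: Ttilde_opE.
  exact: mT.
have [k [L [L0 HL]]] := dual_bound dphi m.
have [s [K [K0 H]]] := Hm k 0%N; have [A A0 hA] := step_dominated s sh.
have [B HB] := bounded_on_disc z0 1 (@wt_continuous _ w m 0%N).
pose M t := K * A * expR B * expR (w m k t).
have FM t z : modulus (z - z0) <= 1 -> modulus (Ttilde_fun g t h z) <= M t.
  move=> zz; rewrite Ttilde_fun_sym /M mulrAC.
  apply: le_trans (H _ _ A0 (@LF_entire _ _ h) hA z t) _.
  rewrite ler_wpM2l ?mulr_ge0 ?expR_ge0// ler_expR.
  by apply: le_trans (ler_norm _) (HB _ zz).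
pose Q z : E := (z - z0)^-1 *: (Ttilde_op g z h - Ttilde_op g z0 h).
have sQ z : step w m (LFfun (Q z)).
  apply: stepZ; rewrite -[- Ttilde_op g z0 h]scaleN1r.
  by apply: stepD; [exact: sT|apply: stepZ; exact: sT].
have QE z t : z != z0 -> Q z t = dquot (Ttilde_fun g t h) z0 z.
  move=> zz; rewrite (dquotE _ zz).
  rewrite [LHS]/((z - z0)^-1 * (Ttilde_op g z h t - Ttilde_op g z0 h t)).
  by rewrite !Ttilde_opE ![Ttilde_fun g t h _]Ttilde_fun_sym mulrC.
have LE z : phi (Q z) = (Ttilde_transform_fun h z - Ttilde_transform_fun h z0) / (z - z0).
  by rewrite /Q (dualZ dphi) (dualB dphi) mulrC.
clearbody Q.
have lip z z' : z != z0 -> z' != z0 -> modulus (z - z0) <= 4^-1 ->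
    modulus (z' - z0) <= 4^-1 ->
    modulus (phi (Q z) - phi (Q z')) <= L * (32 * (32 * (K * A * expR B)) * modulus (z - z')).
  move=> zz z'z z1 z1'; rewrite -(dualB dphi); apply: HL.
  - rewrite -[- Q z']scaleN1r.
    by apply: stepD; [exact: sQ|apply: stepZ; exact: sQ].
  - by rewrite !mulr_ge0 ?expR_ge0 ?modulus_ge0.
  - move=> t; have -> : (Q z - Q z') t = Q z t - Q z' t :> C by [].
    rewrite (QE _ _ zz) (QE _ _ z'z).
    have eF := @Ttilde_fun_entire R g h t (@LF_entire _ _ g) (@LF_entire _ _ h).
    apply: le_trans (dquot_lipschitz eF (FM t) z1 z1') _.
    by rewrite /M le_eqVlt; apply/orP; left; apply/eqP; ring.
pose D := L * (32 * (32 * (K * A * expR B))).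
have D0 : 0 <= D by rewrite /D !mulr_ge0 ?expR_ge0.
have [l Hl] : exists l : C, forall e : R, 0 < e ->
    \forall u \near z0^', modulus (l - phi (Q u)) <= e.
  apply: cauchy_limit => e e0.
  pose d := Num.min 4^-1 (e / (2 * (D + 1))).
  have D1 : 0 < D + 1 by rewrite ltr_wpDl.
  have d0 : 0 < d by rewrite lt_min invr_gt0 ltr0n divr_gt0// mulr_gt0.
  have d2 : 0 < d / 2 by rewrite divr_gt0.
  have dm : modulus ((d / 2)%:C%C : C) = d / 2 by rewrite modulus_nneg ?ltW.
  have dn0 := real_neq0 d2.
  have neq (k1 : C) : k1 != 0 -> z0 + k1 != z0.
    by rewrite -[z0 + k1 == _]subr_eq0 addrAC subrr add0r.
  exists (phi (Q (z0 + (d / 2)%:C%C))); apply/dnear_modulus; exists d => // h1 hd h0.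
  have [d4 de] : d <= 4^-1 /\ d <= e / (2 * (D + 1)).
    by rewrite /d !ge_min !lexx orbT.
  apply: le_trans (lip _ _ (neq _ dn0) (neq _ h0) _ _) _.
  - by rewrite addrAC subrr add0r dm; lra.
  - by rewrite addrAC subrr add0r; lra.
  rewrite mulrA -/D opprD addrACA subrr add0r.
  have : modulus ((d / 2)%:C%C - h1) <= 2 * d.
    by apply: le_trans (modulusB_le _ _) _; rewrite dm; lra.
  rewrite ler_pdivlMr ?mulr_gt0// in de.
  have := modulus_ge0 ((d / 2)%:C%C - h1); nra.
apply/derivable_has_derivP; exists l => e /Hl /dnear_modulus[d d0 Hd]; exists d => // h1 hd.
have [->|h0] := eqVneq h1 0; first by rewrite addr0 mulr0 subr0 subrr Normc.normc0 mulr0.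
have -> : Ttilde_transform_fun h (z0 + h1) - Ttilde_transform_fun h z0 - l * h1 =
    - ((l - phi (Q (z0 + h1))) * h1).
  have e1 : z0 + h1 - z0 = h1 by rewrite addrC addKr.
  by rewrite LE e1 mulrBl divfK//; ring.
by rewrite modulusN Normc.normcM ler_wpM2r ?modulus_ge0//; exact: Hd.
Qed.

Definition Ttilde_transform (h : E) : E := to_LF w (Ttilde_transform_fun h).

Lemma Ttilde_transform_bound n : exists m, forall k, exists s K, 0 <= K /\
  forall h A, step w n (LFfun h) -> 0 <= A -> dominated (w n s) A h ->
    dominated (w m k) (K * A) (Ttilde_transform_fun h).
Proof.
have [m [mT Hm]] := Ttilde_bound g n; exists m => k.
have [k1 [L [L0 HL]]] := dual_bound dphi m.
have [s [K [K0 H]]] := Hm k1 k; exists s, (L * K); split=> [|h A sh A0 hA z].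
  exact: mulr_ge0.
have eh := @LF_entire _ _ h.
have TE : LFfun (Ttilde_op g z h) = Ttilde_fun g z h.
  by apply/funext => t; exact: Ttilde_opE.
rewrite -!mulrA; apply: HL; rewrite ?TE.
- exact: mT.
- by rewrite !mulr_ge0 ?expR_ge0.
- move=> t; apply: le_trans (H A h A0 eh hA z t) _.
  by rewrite le_eqVlt; apply/orP; left; apply/eqP; ring.
Qed.

Lemma Ttilde_transformE h z : Ttilde_transform h z = Ttilde_transform_fun h z.
Proof.
have [n sh] := LF_step h; have [m Hm] := Ttilde_transform_bound n.
rewrite /Ttilde_transform (@to_LFK _ _ m)//; apply: dominated_step.
  exact: Ttilde_transform_entire.
move=> k; have [s [K [_ H]]] := Hm k; have [A A0 hA] := step_dominated s sh.
by exists (K * A); exact: H.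
Qed.

Lemma Ttilde_transform_linear (a : R[i]) (x y : E) :
  Ttilde_transform (a *: x + y) = a *: Ttilde_transform x + Ttilde_transform y.
Proof.
apply: LF_eqP => z; apply: (etrans (Ttilde_transformE _ z)).
apply: (etrans (congr1 phi (Ttilde_op_linear g z a x y))).
apply: (etrans (dphi.1 _ _ _)).
have -> : phi (Ttilde_op g z x) = Ttilde_transform x z by rewrite Ttilde_transformE.
have -> : phi (Ttilde_op g z y) = Ttilde_transform y z by rewrite Ttilde_transformE.
by [].
Qed.

Lemma Ttilde_transform_bounded : bounded_op Ttilde_transform.
Proof.
move=> n; have [m Hm] := Ttilde_transform_bound n; exists m => k.
have [s [K [K0 H]]] := Hm k; exists s, K; split=> // h A sh A0 hA.
have SE : LFfun (Ttilde_transform h) = Ttilde_transform_fun h.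
  by apply/funext => t; rewrite Ttilde_transformE.
rewrite SE; split; last exact: H.
apply: dominated_step; first exact: Ttilde_transform_entire.
move=> k'; have [s' [K' [_ H']]] := Hm k'; have [A' A'0 hA'] := step_dominated s' sh.
by exists (K' * A'); exact: H'.
Qed.

Definition T_transform (h : E) : E := Ttilde_transform (mulX h).

Lemma T_transformE h z : T_transform h z = phi (T_op g z h).
Proof. by rewrite Ttilde_transformE T_opE. Qed.

Lemma T_transform_linear a x y : T_transform (a *: x + y) = a *: T_transform x + T_transform y.
Proof. by rewrite /T_transform mulX_linear Ttilde_transform_linear. Qed.

Hypothesis g0 : g 0 = 1.

Lemma T_op0 h : T_op g 0 h = h.
Proof. by rewrite T_op_Ttilde g0 scale1r scale0r addr0. Qed.

Lemma T_transform0 h : T_transform h 0 = phi h.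
Proof. by rewrite T_transformE T_op0. Qed.

(** Both sides are the transform [Ttilde_transform]. *)
Lemma T_transform_pommiez h : T_transform (pommiez g h) = pommiez g (T_transform h).
Proof.
have -> : T_transform (pommiez g h) = Ttilde_transform h.
  apply: LF_eqP => z; apply: (etrans (Ttilde_transformE _ z)).
  apply: (etrans _ (esym (Ttilde_transformE _ z))).
  apply: (congr1 phi); rewrite (mulX_pommiez h g0).
  apply: (etrans (Ttilde_op_linear g z _ g h)).
  by rewrite Ttilde_op_self scaler0 add0r.
apply: mulX_inj; rewrite (mulX_pommiez (T_transform h) g0); apply: LF_eqP => z.
apply: (etrans (mulXE _ z)).
apply: (etrans (congr1 (fun c : C => z * c) (Ttilde_transformE h z))).
have E1 : (- (T_transform h 0) *: g + T_transform h) z = - phi h * g z + T_transform h z :> C.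
  exact: (congr1 (fun c : C => - c * g z + T_transform h z) (T_transform0 h)).
apply: (etrans _ (esym E1)).
have E2 : T_transform h z = g z * phi h + z * phi (Ttilde_op g z h).
  by rewrite T_transformE T_op_Ttilde (dualD dphi) !(dualZ dphi).
apply: (etrans _ (esym (congr1 (fun c : C => - phi h * g z + c) E2))).
rewrite /Ttilde_transform_fun; ring.
Qed.

Lemma T_transform_bounded : bounded_op T_transform.
Proof. exact: (bounded_op_comp Ttilde_transform_bounded mulX_bounded). Qed.

End Resolvent.
End BoundedOperators.

(** * The Hahn-Banach theorem *)

Section Sublinear.
Variables (R : realType) (E : lmodType R[i]).
Implicit Types (p q : E -> R) (x y : E).

Definition sublinear p :=
  (forall x y, p (x + y) <= p x + p y) /\
  (forall (r : R) x, 0 <= r -> p (r%:C%C *: x) <= r * p x).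

Section SublinearTheory.
Variable p : E -> R.
Hypothesis sp : sublinear p.

Lemma sublinear0 : p 0 = 0.
Proof.
have := sp.2 0 0 (lexx 0); rewrite scaler0 mul0r => p0.
have := sp.1 0 0; rewrite addr0 => p00; lra.
Qed.

Lemma sublinearZ (r : R) x : 0 <= r -> p (r%:C%C *: x) = r * p x.
Proof.
rewrite le_eqVlt => /predU1P[<-|r0]; first by rewrite scale0r mul0r sublinear0.
apply/eqP; rewrite eq_le (sp.2 _ _ (ltW r0)) /= -ler_pdivlMl//.
have rV0 : 0 <= r^-1 by rewrite invr_ge0 ltW.
have := sp.2 r^-1 (r%:C%C *: x) rV0.
by rewrite scalerA -rmorphM mulVf ?gt_eqF// scale1r.
Qed.

Lemma sublinear_opp x : - p (- x) <= p x.
Proof. by have := sp.1 x (- x); rewrite subrr sublinear0; lra. Qed.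

End SublinearTheory.

(** The largest sublinear functional below [q] whose value at [- y] is at most
    [- q y], so that linear functionals below it are maximal at [y]. *)
Definition shear q y x : R :=
  inf [set q (x + t%:C%C *: y) - t * q y | t in [set t : R | 0 <= t]].

Section Shear.
Variables (q : E -> R) (y : E).
Hypothesis sq : sublinear q.

Lemma shear_le (t : R) x : 0 <= t -> shear q y x <= q (x + t%:C%C *: y) - t * q y.
Proof.
move=> t0; apply: ge_inf; last by exists t.
exists (- q (- x)) => _ [s s0 <-]; have := sq.1 (x + s%:C%C *: y) (- x).
by rewrite addrAC subrr add0r sublinearZ//; lra.
Qed.

Lemma le_shear x (b : R) :
  (forall t, 0 <= t -> b <= q (x + t%:C%C *: y) - t * q y) -> b <= shear q y x.
Proof.
move=> H; apply: lb_le_inf; last by move=> _ [t t0 <-]; exact: H.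
by exists (q (x + 0%:C%C *: y) - 0 * q y); exists 0 => /=.
Qed.

Lemma shear_le_self x : shear q y x <= q x.
Proof. by have := shear_le x (lexx 0); rewrite scale0r addr0 mul0r subr0. Qed.

Lemma shear_opp : shear q y (- y) <= - q y.
Proof.
have := shear_le (- y) ler01; rewrite scale1r addNr sublinear0// mul1r; lra.
Qed.

Lemma shear_sublinear : sublinear (shear q y).
Proof.
split=> [x x'|r x].
  have H t t' : 0 <= t -> 0 <= t' -> shear q y (x + x') <=
      q (x + t%:C%C *: y) - t * q y + (q (x' + t'%:C%C *: y) - t' * q y).
    move=> t0 t'0; apply: le_trans (shear_le _ (addr_ge0 t0 t'0)) _.
    rewrite rmorphD scalerDl addrACA mulrDl.
    by have := sq.1 (x + t%:C%C *: y) (x' + t'%:C%C *: y); lra.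
  rewrite -lerBlDr; apply: le_shear => t t0; rewrite lerBlDr [leRHS]addrC -lerBlDr.
  by apply: le_shear => t' t'0; rewrite lerBlDr [leRHS]addrC; exact: H.
rewrite le_eqVlt => /predU1P[<-|r0].
  by rewrite scale0r mul0r -[leRHS](sublinear0 sq); exact: shear_le_self.
rewrite -ler_pdivrMl//; apply: le_shear => t t0; rewrite ler_pdivrMl//.
have rt : 0 <= r * t by rewrite mulr_ge0// ltW.
apply: le_trans (shear_le _ rt) _.
by rewrite rmorphM -scalerA -scalerDr (sublinearZ sq _ (ltW r0)) mulrBr mulrA.
Qed.

End Shear.

Definition sublinear_below p := {q : E -> R | sublinear q /\ forall x, q x <= p x}.

(** By Zorn's lemma. Minimality is a step towards linearity: a minimal functional
    is equal to each of its shears. *)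
Theorem exists_minimal_sublinear p : sublinear p ->
  exists m : E -> R, [/\ sublinear m, forall x, m x <= p x &
    forall q, sublinear q -> (forall x, q x <= m x) -> q = m].
Proof.
move=> sp; pose Rel (s t : sublinear_below p) := `[< forall x, sval t x <= sval s x >].
have [||||[m [sm mp]] Hm] := @Zorn (sublinear_below p) Rel.
- by move=> t; apply/asboolP => x.
- move=> r s t /asboolP rs /asboolP st; apply/asboolP => x.
  exact: le_trans (st x) (rs x).
- move=> s t /asboolP st /asboolP ts; apply: eq_sig_hprop => [u|].
    by move=> ? ?; exact: Prop_irrelevance.
  by apply/funext => x; apply/eqP; rewrite eq_le ts st.
- move=> A totA.
  have [->|/set0P[a Aa]] := eqVneq A set0.
    by exists (exist _ p (conj sp (fun x => lexx (p x)))).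
  pose q x := inf [set sval s x | s in A].
  have q_le s x : A s -> q x <= sval s x.
    move=> As; apply: ge_inf; last by exists s.
    exists (- p (- x)) => _ [[u [su up]] _ <-] /=.
    by have := sublinear_opp su x; have := up (- x); lra.
  have le_q x b : (forall s, A s -> b <= sval s x) -> b <= q x.
    move=> H; apply: lb_le_inf; last by move=> _ [s As <-]; exact: H.
    by exists (sval a x); exists a.
  have sq : sublinear q.
    split=> [x y|r x].
      have H s t : A s -> A t -> q (x + y) <= sval s x + sval t y.
        move=> As At.
        have Hs u : A u -> q (x + y) <= sval u x + sval u y.
          by move=> Au; apply: le_trans (q_le _ _ Au) _; case: (svalP u) => -[+ _] _; apply.
        have [/asboolP st|/asboolP ts] := totA s t As At.
          by apply: le_trans (Hs _ At) _; rewrite lerD2r.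
        by apply: le_trans (Hs _ As) _; rewrite lerD2l.
      rewrite -lerBlDr; apply: (le_q) => s As; rewrite lerBlDr [leRHS]addrC -lerBlDr.
      by apply: (le_q) => t At; rewrite lerBlDr [leRHS]addrC; exact: H.
    rewrite le_eqVlt => /predU1P[<-|r0].
      rewrite scale0r mul0r; apply: le_trans (q_le a _ Aa) _.
      by rewrite (sublinear0 (svalP a).1).
    rewrite -ler_pdivrMl//; apply: (le_q) => s As; rewrite ler_pdivrMl//.
    apply: le_trans (q_le s _ As) _.
    by rewrite (sublinearZ (svalP s).1 _ (ltW r0)).
  have qp x : q x <= p x by apply: le_trans (q_le a x Aa) ((svalP a).2 x).
  by exists (exist _ q (conj sq qp)) => s As; apply/asboolP => x; exact: q_le.
exists m; split=> // q sq qm.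
have qp x : q x <= p x by exact: le_trans (qm x) (mp x).
have := Hm (exist _ q (conj sq qp)); rewrite /Rel /= => H.
by have /(congr1 sval) := H (asboolT qm).
Qed.

(** A minimal sublinear functional below the shear of [p] at [y0]. *)
Theorem real_hahn_banach p y0 : sublinear p -> exists m : E -> R,
  [/\ forall x y, m (x + y) = m x + m y,
      forall (r : R) x, m (r%:C%C *: x) = r * m x,
      forall x, m x <= p x & p y0 <= m y0].
Proof.
move=> sp; have ss := shear_sublinear y0 sp.
have [m [sm mp minm]] := exists_minimal_sublinear ss.
have mD x y : m (x + y) = m x + m y.
  apply/eqP; rewrite eq_le sm.1 /=.
  have := shear_le y sm x ler01.
  rewrite (minm _ (shear_sublinear y sm) (shear_le_self y sm)) scale1r mul1r; lra.
have mN x : m (- x) = - m x.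
  by have := mD x (- x); rewrite subrr sublinear0//; lra.
exists m; split=> // [r x|x|].
- have [r0|r0] := leP 0 r; first exact: sublinearZ.
  have rN : 0 <= - r by rewrite oppr_ge0 ltW.
  have := sublinearZ sm x rN; rewrite rmorphN scaleNr mN mulNr; exact: oppr_inj.
- exact: le_trans (mp x) (shear_le_self y0 sp x).
- have := shear_opp y0 sp; have := mp (- y0); rewrite mN; lra.
Qed.

End Sublinear.

(** * Separation from a closed span *)

Section Separation.
Variables (R : realType) (w : weights R).
Local Notation E := (LFspace w).
Implicit Types (S : set E) (x y : E).

Lemma lin_span_sub S x : S x -> lin_span S x.
Proof.
move=> Sx; exists 1%N, (fun=> 1), (fun=> x); split=> //.
by rewrite big_ord1 scale1r.
Qed.

Lemma lin_span0 S : lin_span S 0.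
Proof.
by exists 0%N, (fun=> 0), (fun=> 0); split=> [[]//|]; rewrite big_ord0.
Qed.

Lemma lin_spanD S x y : lin_span S x -> lin_span S y -> lin_span S (x + y).
Proof.
move=> [n [c [u [Su ->]]]] [m [d [v [Sv ->]]]].
exists (n + m)%N,
  (fun i : 'I_(n + m)%N => match fintype.split i with inl j => c j | inr j => d j end),
  (fun i : 'I_(n + m)%N => match fintype.split i with inl j => u j | inr j => v j end); split.
  by move=> i; case: (fintype.split i).
rewrite big_split_ord /=; congr (_ + _); apply: eq_bigr => i _.
  by rewrite (unsplitK (inl i : ('I_n + 'I_m)%type)).
by rewrite (unsplitK (inr i : ('I_n + 'I_m)%type)).
Qed.

Lemma lin_spanZ S (a : R[i]) x : lin_span S x -> lin_span S (a *: x).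
Proof.
move=> [n [c [u [Su ->]]]]; exists n, (fun i => a * c i), u; split=> //.
by rewrite scaler_sumr; apply: eq_bigr => i _; rewrite scalerA.
Qed.

(** The Minkowski functional of [V + span S]. *)
Definition gauge (V S : set E) (x : E) : R :=
  inf [set r : R | 0 < r /\ exists v u, [/\ V v, lin_span S u & x = r%:C%C *: v + u]].

Section Gauge.
Variables (V S : set E).
Hypothesis bV : LF_base V.

Lemma gauge_le x (r : R) v u : 0 < r -> V v -> lin_span S u ->
  x = r%:C%C *: v + u -> gauge V S x <= r.
Proof.
move=> r0 Vv Su xE; apply: ge_inf; last by split=> //; exists v, u.
by exists 0 => s [/ltW].
Qed.

Lemma le_gauge x (b : R) : (forall r v u, 0 < r -> V v -> lin_span S u ->
  x = r%:C%C *: v + u -> b <= r) -> b <= gauge V S x.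
Proof.
move=> H; apply: lb_le_inf; last by move=> r [r0 [v [u [Vv Su xE]]]]; exact: (H r v u).
have [r r0 Vr] := LF_base_absorb x bV.
exists r^-1; split; first by rewrite invr_gt0.
exists (r%:C%C *: x), 0; split=> //; first exact: lin_span0.
by rewrite addr0 scalerA -rmorphM mulVf ?gt_eqF// scale1r.
Qed.

Lemma gauge_sublinear : sublinear (gauge V S).
Proof.
split=> [x y|r x].
  rewrite -lerBlDr; apply: le_gauge => r v u r0 Vv Su xE.
  rewrite lerBlDr [leRHS]addrC -lerBlDr.
  apply: le_gauge => s v' u' s0 Vv' Su' yE; rewrite lerBlDr [leRHS]addrC.
  have rs : 0 < r + s by rewrite addr_gt0.
  apply: (@gauge_le _ _ ((r / (r + s))%:C%C *: v + (s / (r + s))%:C%C *: v') (u + u')) => //.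
  - apply: bV.1 => //; rewrite !modulus_nneg ?divr_ge0 ?(ltW r0) ?(ltW s0) ?(ltW rs)//.
    by rewrite -mulrDl mulfV// gt_eqF.
  - exact: lin_spanD.
  - rewrite xE yE addrACA; congr (_ + _); rewrite scalerDr !scalerA -!rmorphM.
    by rewrite ![(r + s) * _]mulrC !divfK ?gt_eqF.
rewrite le_eqVlt => /predU1P[<-|r0].
  rewrite scale0r mul0r; apply/ler_addgt0Pr => e e0; rewrite add0r.
  apply: (@gauge_le _ e 0 0) => //; first exact: LF_base0.
    exact: lin_span0.
  by rewrite scaler0 addr0.
rewrite -ler_pdivrMl//; apply: le_gauge => s v u s0 Vv Su xE; rewrite ler_pdivrMl//.
apply: (@gauge_le _ _ v (r%:C%C *: u)) => //; first by rewrite mulr_gt0.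
  exact: lin_spanZ.
by rewrite xE scalerDr scalerA -rmorphM.
Qed.

Lemma gauge_span u : lin_span S u -> gauge V S u <= 0.
Proof.
move=> Su; apply/ler_addgt0Pr => e e0; rewrite add0r.
apply: (@gauge_le _ e 0 u) => //; first exact: LF_base0.
by rewrite scaler0 add0r.
Qed.

Lemma gauge_base v : V v -> gauge V S v <= 1.
Proof.
move=> Vv; apply: (@gauge_le _ 1 v 0) => //; first exact: lin_span0.
by rewrite scale1r addr0.
Qed.

Lemma gauge_ge1 x : (forall y, V (y - x) -> ~ lin_span S y) -> 1 <= gauge V S x.
Proof.
move=> H; apply: le_gauge => r v u r0 Vv Su xE; rewrite leNgt; apply/negP => r1.
apply: (H u) Su; rewrite xE opprD addrCA subrr addr0 -scaleNr.
by apply: LF_base_bal => //; rewrite modulusN modulus_nneg ?ltW.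
Qed.

End Gauge.

(** Some [x0 + V] misses the span of [S], so that the gauge of [V + span S] is 0 on
    the span and at least 1 at [x0]. With [m] the real functional below this gauge,
    [phi x] is [m x - 'i * m ('i * x)]; it is at most 2 on [V], whence the factor 2
    in the neighbourhood on which it is at most 1. *)
Theorem not_complete_dual S : ~ complete_system S -> exists phi : E -> R[i],
  [/\ in_dual phi, forall s, S s -> phi s = 0 & exists x, phi x <> 0].
Proof.
move=> /existsNP[U /not_implyP[[x0 Ux0] /not_implyP[oU nUS]]].
have /LF_nbhsE[V bV VU] : nbhs x0 U by exact: open_nbhs_nbhs.
have disj y : V (y - x0) -> ~ lin_span S y.
  by move=> /VU Uy Sy; apply: nUS; exists y.
have [m [mD mZ mp mx0]] := real_hahn_banach x0 (gauge_sublinear S bV).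
have mN x : m (- x) = - m x.
  by have := mZ (-1) x; rewrite rmorphN rmorph1 scaleN1r mulN1r.
pose phi x : R[i] := (m x +i* (- m ('i%C *: x)))%C.
have cE (a : R[i]) : a = (complex.Re a)%:C%C + (complex.Im a)%:C%C * 'i%C.
  case: a => b c; apply/eqP; rewrite eq_complex /=.
  by rewrite !mulr0 !mul0r !mulr1 subr0 !addr0 add0r !eqxx.
have m_cplx a x : m (a *: x) = complex.Re a * m x + complex.Im a * m ('i%C *: x).
  by rewrite [in LHS](cE a) scalerDl mD mZ -scalerA mZ.
have m_i a x : m ('i%C *: (a *: x)) = complex.Re a * m ('i%C *: x) - complex.Im a * m x.
  rewrite scalerA m_cplx; case: (a) => b c /=.
  by rewrite !mul0r !mul1r sub0r add0r addrC mulNr.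
have m_abs x b : m x <= b -> m (- x) <= b -> `|m x| <= b.
  by rewrite mN ler_norml => h1 h2; rewrite h1 andbT lerNl.
exists phi; split.
- split=> [a x y|].
    apply/eqP; rewrite eq_complex; apply/andP; split; apply/eqP.
      rewrite raddfD /= mD m_cplx; case: (a) => b c /=; ring.
    rewrite raddfD /= scalerDr mD m_i; case: (a) => b c /=; ring.
  exists [set x | V (2 *: x)]; first exact: LF_base_scale.
  move=> v /= Vv; pose u := 2 *: v : E.
  have phi1 : modulus (phi u) <= 2.
    have bal (c : R[i]) : modulus c <= 1 -> m (c *: u) <= 1.
      move=> c1; apply: le_trans (mp _) _; apply: gauge_base.
      exact: LF_base_bal.
    apply: le_trans (modulus_le_Re_Im _) _; rewrite /= normrN.
    have i1 : modulus ('i%C : R[i]) <= 1 by rewrite /= expr0n /= add0r expr1n sqrtr1.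
    have : `|m u| <= 1.
      apply: m_abs; first by have := bal 1; rewrite scale1r Normc.normc1; apply.
      by have := bal (-1); rewrite scaleN1r (@modulusN R 1) Normc.normc1; apply.
    have : `|m ('i%C *: u)| <= 1.
      apply: m_abs; first exact: bal.
      by rewrite -scaleNr; apply: bal; rewrite (@modulusN R 'i%C).
    lra.
  have : phi u = 2 * phi v.
    apply/eqP; rewrite eq_complex; apply/andP; split; apply/eqP.
      by rewrite /= m_cplx /=; ring.
    by rewrite /= m_i /=; ring.
  move=> E2; move: phi1; rewrite E2 Normc.normcM.
  have -> : modulus (2 : R[i]) = 2 by exact: (@modulus_nat R 2).
  by move=> h; have : modulus (phi v) <= 1 by lra.
- move=> s /lin_span_sub Ss; have zero u : lin_span S u -> m u = 0.
    move=> Su; apply/eqP; rewrite eq_le; apply/andP; split.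
      by apply: le_trans (mp _) (gauge_span bV Su).
    rewrite -oppr_le0 -mN; apply: le_trans (mp _) (gauge_span bV _).
    by rewrite -scaleN1r; exact: lin_spanZ.
  by rewrite /phi !zero ?oppr0//; exact: lin_spanZ.
- exists x0 => /(congr1 (@complex.Re R)) /= m0.
  by have := gauge_ge1 bV disj; rewrite m0 in mx0; lra.
Qed.

Lemma dual_complete S phi : complete_system S -> in_dual phi ->
  (forall s, S s -> phi s = 0) -> forall x, phi x = 0.
Proof.
move=> cS dphi S0 x; apply: contrapT => px; have [_ [V bV Vphi]] := dphi.
have p0 : 0 < modulus (phi x) by apply: modulus_gt0; apply/eqP.
pose c : R[i] := (2 / modulus (phi x))%:C%C.
have : nbhs x [set y | V (c *: (y - x))].
  by apply/LF_nbhsE; exists [set v | V (c *: v)] => //; exact: LF_base_scale.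
rewrite nbhsE => -[U [oU Ux] UV].
have [y [/UV Vy [n [d [u [Su yE]]]]]] := cS U (ex_intro _ x Ux) oU.
have py : phi y = 0.
  by rewrite yE (dual_sum dphi) big1// => i _; rewrite S0// mulr0.
have := Vphi _ Vy; rewrite (dualZ dphi) (dualB dphi) py sub0r Normc.normcM modulusN.
rewrite modulus_nneg ?divr_ge0 ?modulus_ge0// divfK ?gt_eqF//; lra.
Qed.

End Separation.

(** * Cyclic vectors and the commutant *)

Section CyclicVectors.
Variables (R : realType) (w : weights R).
Local Notation C := (Cplx R).
Local Notation E := (LFspace w).

Lemma linear_pack (T : E -> E) : (forall a x y, T (a *: x + y) = a *: T x + T y) ->
  exists B : {linear E -> E}, forall h, B h = T h.
Proof.
move=> lT; pose mixin := GRing.isLinear.Build R[i] E E *:%R T lT.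
by exists (HB.pack T mixin : {linear E -> E}).
Qed.

Lemma eval0_base : LF_base [set h : E | modulus (h 0) <= 1].
Proof.
split=> [a b x y ab x1 y1|n] /=.
  suff : modulus (a * x 0 + b * y 0 : C) <= 1 by [].
  apply: le_trans (modulusD_le _ _) _; rewrite !Normc.normcM; apply: le_trans ab.
  by rewrite lerD// ler_piMr ?modulus_ge0.
exists 0%N, (expR (w n 0%N 0))^-1 => [|h sh nh]; first by rewrite invr_gt0 expR_gt0.
have /weighted_norm_leP/(_ 0) := ltW (nh 0%N (leqnn 0)).
by rewrite mulVf// gt_eqF// expR_gt0.
Qed.

Variable g : E.
Hypothesis g0 : g 0 = 1.
Local Notation D := (pommiez g).

Lemma pommiez_linear (a : R[i]) (x y : E) : D (a *: x + y) = a *: D x + D y.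
Proof.
by rewrite (pommiezE (a *: x + y) g0) (pommiezE x g0) (pommiezE y g0) Ttilde_op_linear.
Qed.

Lemma pommiez_bounded : bounded_op D.
Proof.
move=> n; have [m [mT Hm]] := Ttilde_bound g n; exists m => k.
have [s [K [K0 H]]] := Hm k 0%N; exists s, (K * expR (w m 0%N 0)).
split=> [|h A sh A0 hA]; first by rewrite mulr_ge0 ?expR_ge0.
have eh := @LF_entire _ _ h.
have DE : LFfun (D h) = Ttilde_fun g 0 h.
  by apply/funext => t; rewrite (pommiezE h g0) Ttilde_opE.
rewrite DE; split; first exact: mT.
move=> t; have -> : K * expR (w m 0%N 0) * A * expR (w m k t) =
    K * A * expR (w m k t) * expR (w m 0%N 0) by ring.
exact: H.
Qed.

Lemma iter_pommiez0 n : iter n D 0 = 0.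
Proof.
have D0 : D 0 = 0.
  have := pommiez_linear 1 0 0; rewrite !scale1r addr0 => /esym/eqP.
  by rewrite -subr_eq0 addrK => /eqP.
by elim: n => //= n ->.
Qed.

Lemma iter_pommiezB n x y : iter n D (x - y) = iter n D x - iter n D y.
Proof.
elim: n => //= n ->.
by rewrite -[- iter n D y]scaleN1r addrC pommiez_linear scaleN1r addrC.
Qed.

(** [D] divides by [t] the functions vanishing at 0, so [u] is [t ^ n] times an
    entire function for all [n]; the maximum principle makes it vanish. *)
Lemma pommiez_orbit_eq0 u : (forall n, iter n D u 0 = 0) -> u = 0.
Proof.
move=> un; have uE n t : u t = t ^+ n * iter n D u t.
  elim: n => [|n IH]; first by rewrite expr0 mul1r.
  rewrite exprSr -mulrA IH; congr (_ * _).
  rewrite -[iter n.+1 D u]/(D (iter n D u)) -mulXE mulX_pommiez// un.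
  by rewrite oppr0 scale0r add0r.
apply: LF_eqP => t; have [->|t0] := eqVneq t 0; first exact: (un 0%N).
have pt := modulus_gt0 t0; pose r := 6 * modulus t.
have r0 : 0 < r by rewrite mulr_gt0.
have [M HM] := bounded_on_disc t r (modulus_continuous (entire_continuous (@LF_entire _ _ u))).
have {}HM s : modulus (s - t) <= r -> modulus (u s) <= M.
  by move=> /HM; exact: le_trans (ler_norm _).
apply: modulus_le0; rewrite leNgt; apply/negP => ut.
suff : (2 : R) <= 1 by lra.
apply: (@le_of_powers _ _ _ _ M ut ler01) => n; rewrite expr1n mulr1.
rewrite {1}(uE n t) Normc.normcM modulusX -mulrA mulrC -mulrA -exprMn -/(2 * modulus t).
have bt : 0 < (2 * modulus t) ^+ n by rewrite exprn_gt0// mulr_gt0.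
rewrite -ler_pdivlMr//.
have eD := @LF_entire _ _ (iter n D u).
have mm := @max_modulus_off R (iter n D u) [::] t r (M / (2 * modulus t) ^+ n) r0.
apply: mm; [exact: entire_continuous|by move=> s _; exact: eD|by []|move=> s /andP[s1 s2]].
rewrite ler_pdivlMr//; apply: le_trans (HM s s2); rewrite (uE n s) Normc.normcM modulusX mulrC.
rewrite ler_wpM2r ?modulus_ge0// lerXn2r ?nnegrE ?mulr_ge0 ?modulus_ge0//.
have := modulusB_le s t; rewrite /r in s1; lra.
Qed.

Lemma commutant_iter (B : E -> E) (x : E) n : (forall x, B (D x) = D (B x)) ->
  B (iter n D x) = iter n D (B x).
Proof. by move=> H; elim: n => //= n <-. Qed.

Lemma commutant_dual (B : {linear E -> E}) : continuous B -> in_dual (fun h => B h 0).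
Proof.
move=> cB; split=> [a x y|]; first by rewrite linearP.
have B0 : nbhs (B 0) [set h : E | modulus (h 0) <= 1].
  apply/LF_nbhsE; exists [set h : E | modulus (h 0) <= 1]; first exact: eval0_base.
  by move=> y; rewrite linear0 subr0.
have /LF_nbhsE[V bV VB] := cB 0 _ B0; exists V => // v Vv.
by apply: VB; rewrite subr0.
Qed.

(** The two sides have the same value at 0, for all [h]. Replacing [h] by its orbit
    under [D], which commutes with both operators, gives them the same orbit at 0. *)
Lemma commutant_T_transform (B : {linear E -> E}) h : commutant D B ->
  B h = T_transform g (fun h => B h 0) h.
Proof.
move=> [cB BD]; have dphi := commutant_dual cB.
apply/eqP; rewrite -subr_eq0; apply/eqP; apply: pommiez_orbit_eq0 => n.
rewrite iter_pommiezB -(commutant_iter _ _ BD).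
rewrite -(commutant_iter _ _ (T_transform_pommiez dphi g0)).
set k := iter n D h.
have -> : (B k - T_transform g (fun h => B h 0) k) 0 =
    B k 0 - T_transform g (fun h => B h 0) k 0 :> C by [].
by rewrite (T_transform0 dphi g0) subrr.
Qed.

Lemma T_transform_commutant phi : in_dual phi -> exists2 B : {linear E -> E},
  commutant D B & forall h, B h = T_transform g phi h.
Proof.
move=> dphi; have [B BE] := linear_pack (T_transform_linear g dphi).
exists B => //; split; last by move=> h; rewrite !BE T_transform_pommiez.
apply: bounded_op_continuous => n; have [m Hm] := T_transform_bounded g dphi n.
exists m => k; have [s [K [K0 H]]] := Hm k; exists s, K; split=> // h A sh A0 hA.
by rewrite BE; exact: H.
Qed.

Definition avoids_kernels (f : E) := forall B : {linear E -> E},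
  commutant D B -> (exists h, B h <> 0) -> B f <> 0.

(** By separation, completeness of [S] says that no nonzero continuous functional
    vanishes on [S], and functionals are the same as operators of the commutant. *)
Lemma complete_avoids (S : set E) f :
  (forall phi, in_dual phi -> (forall s, S s -> phi s = 0) <-> T_transform g phi f = 0) ->
  complete_system S <-> avoids_kernels f.
Proof.
move=> H; split=> [cS B cB [h Bh] Bf|af].
  apply: Bh; have dphi := commutant_dual cB.1.
  have S0 := (H _ dphi).2 (etrans (esym (commutant_T_transform f cB)) Bf).
  apply: (etrans (commutant_T_transform h cB)); apply: LF_eqP => z.
  exact: (etrans (T_transformE g dphi h z) (dual_complete cS dphi S0 _)).
apply: contrapT => /not_complete_dual[phi [dphi S0 [x px]]].
have [B cB BE] := T_transform_commutant dphi; have Bf := (H _ dphi).1 S0.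
apply: (af B cB); last by rewrite BE.
exists x => /(congr1 (fun h : E => h 0)); rewrite BE (T_transform0 dphi g0); exact: px.
Qed.

(** [phi (D ^ n f)] is the value at 0 of [D ^ n (T_transform g phi f)]. *)
Lemma cyclic_avoids f : cyclic_vectors D f <-> avoids_kernels f.
Proof.
apply: complete_avoids => phi dphi; have BD := T_transform_pommiez dphi g0.
have key n : phi (iter n D f) = iter n D (T_transform g phi f) 0.
  by rewrite -(commutant_iter _ _ BD) (T_transform0 dphi g0).
split=> [H|H _ [n _ <-]]; last by rewrite key H iter_pommiez0.
by apply: pommiez_orbit_eq0 => n; rewrite -key; apply: H; exists n.
Qed.

Lemma T_complete_avoids f : complete_system (range (fun z : C => T_op g z f)) <->
  avoids_kernels f.
Proof.
apply: complete_avoids => phi dphi; split=> [H|H _ [z _ <-]].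
  by apply: LF_eqP => z; rewrite (T_transformE _ dphi); apply: H; exists z.
by rewrite -(T_transformE _ dphi) H.
Qed.

Lemma Ttilde_T f z : Ttilde_op g z f = T_op g z (D f).
Proof.
rewrite T_opE (mulX_pommiez _ g0) (Ttilde_op_linear g z _ g f) Ttilde_op_self.
by rewrite scaler0 add0r.
Qed.

(** For [B] in the commutant, so is [B \o D], and it is not 0 if [B] is not,
    since [D] is onto. *)
Lemma avoids_pommiez f : avoids_kernels f <-> avoids_kernels (D f).
Proof.
split=> af B cB Bn0 Bf; last first.
  by apply: (af B cB Bn0); rewrite cB.2 Bf; exact: (iter_pommiez0 1).
have [h Bh] := Bn0; have [D' D'E] := linear_pack pommiez_linear.
have [B' B'E] : exists B' : {linear E -> E}, forall x, B' x = B (D x).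
  by apply: linear_pack => a x y; rewrite pommiez_linear linearP.
apply: (af B'); last by rewrite B'E.
  split; last by move=> x; rewrite !B'E !cB.2.
  have cD : continuous D'.
    apply: bounded_op_continuous => n; have [m Hm] := pommiez_bounded n.
    exists m => k; have [s [K [K0 H]]] := Hm k; exists s, K; split=> // u A su A0 uA.
    by rewrite D'E; exact: H.
  have -> : (B' : E -> E) = B \o D' by apply/funext => x; rewrite B'E /= D'E.
  by move=> x; apply: continuous_comp; [exact: cD|exact: cB.1].
by exists (mulX h); rewrite B'E (pommiez_mulX _ g0).
Qed.

End CyclicVectors.

Theorem theorem9 (R : realType) (w : weights R)
    (E_neq0 : exists h : LFspace w, h != 0)
    (g0 : LFspace w) (g0_at0 : g0 0 = 1) (f : LFspace w) :
  let i := cyclic_vectors (pommiez g0) f in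
  let ii := complete_system (range (fun z : Cplx R => T_op g0 z f)) in
  let iii := forall B : {linear LFspace w -> LFspace w},
    commutant (pommiez g0) B -> (exists h, B h <> 0) -> B f <> 0 in
  let iv := complete_system (range (fun z : Cplx R => Ttilde_op g0 z f)) in
  [/\ i <-> ii, ii <-> iii & iii <-> iv].
Proof.
move=> i ii iii iv.
have h1 : i <-> iii := cyclic_avoids g0_at0 f.
have h2 : ii <-> iii := T_complete_avoids g0_at0 f.
have h3 : iii <-> iv.
  rewrite /iv; have -> : (fun z => Ttilde_op g0 z f) = fun z => T_op g0 z (pommiez g0 f).
    by apply/funext => z; exact: Ttilde_T.
  apply: (iff_trans (avoids_pommiez g0_at0 f)).
  exact: iff_sym (T_complete_avoids g0_at0 (pommiez g0 f)).
by split=> //; apply: (iff_trans h1); exact: iff_sym.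
Qed.
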